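(* Let $k$ be an algebraically closed field of odd characteristic $p$, let $H=H_{1,\mathbf{c}}(V,\omega,\Gamma)$ be a symplectic reflection algebra over $k$ with $t=1$, where $p\nmid|\Gamma|$, let $Z$ be the centre of $H$, and let $e=\frac{1}{|\Gamma|}\sum_{\gamma\in\Gamma}\gamma\in k\Gamma\subseteq H$. The map $\theta:H\to eHe$, $u\mapsto eue$, is an algebra homomorphism when restricted to $Z$, and maps $Z$ isomorphically to the centre of $eHe$.
   Context: Symplectic reflection algebra: $(V,\omega)$ is a finite dimensional symplectic $k$-vector space, $\Gamma$ a finite group of symplectic automorphisms of $V$, generated by its set $S$ of symplectic reflections (elements $s$ for which $\mathrm{Id}-s$ has rank 2), and $\mathbf{c}:S\to k$, $s\mapsto c_s$, is a $\Gamma$-invariant (under conjugation) function. $H_{1,\mathbf{c}}(V,\omega,\Gamma)$ is the factor of the skew group algebra $T(V)*\Gamma$ of the tensor algebra by the relations $$xy-yx=\omega(x,y)1_\Gamma-\sum_{s\in S}c_s\,\omega_s(x,y)\,s\qquad(x,y\in V),$$ where $\omega_s$ is the skew-symmetric form on $V$ having $\ker(\mathrm{Id}-s)$ in its radical and coinciding with $\omega$ on $\mathrm{im}(\mathrm{Id}-s)$. The group algebra $k\Gamma$ embeds in $H$, and $eHe$ is an algebra with identity $e$. *)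

(* Defs.v *)
From HB Require Import structures.
From mathcomp Require Import all_boot all_fingroup all_order all_algebra all_solvable.
From mathcomp Require Import boolp.
From mathcomp Require Import monalg.

Set Implicit Arguments.
Unset Strict Implicit.
Unset Printing Implicit Defensive.

Import GRing.Theory.

Local Open Scope quotient_scope.
Local Open Scope ring_scope.

Section IdealQuotient.
Variables (R : nzRingType) (A : algType R) (X : A -> Prop).

Inductive in_ideal : A -> Prop :=
| in_ideal_gen x of X x : in_ideal x
| in_ideal0 : in_ideal 0
| in_idealD x y of in_ideal x & in_ideal y : in_ideal (x + y)
| in_idealM a x b of in_ideal x : in_ideal (a * x * b).

Definition ideal_gen : pred A := fun x => `[< in_ideal x >].

Lemma ideal_genP x : reflect (in_ideal x) (x \in ideal_gen).
Proof. exact: asboolP. Qed.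

Lemma ideal_gen_zmod_closed : zmod_closed ideal_gen.
Proof.
split=> [|x y /ideal_genP Ix /ideal_genP Iy]; apply/ideal_genP.
  exact: in_ideal0.
apply: in_idealD => //; have := in_idealM (-1) 1 Iy.
by rewrite mulN1r mulr1.
Qed.

HB.instance Definition _ := GRing.isZmodClosed.Build A ideal_gen
  ideal_gen_zmod_closed.

Definition ideal_zmod : zmodClosed A := GRing.ZmodClosed.clone A ideal_gen _.

(* The ideal may be the whole algebra, so the quotient is only a [pzRingType]   *)
(* with an [lmodType] structure: MathComp's [algType] requires 1 != 0.         *)
Definition quot_alg : Type := Quotient.quot ideal_zmod.

HB.instance Definition _ := GRing.Zmodule.on quot_alg.

Definition quot_pi (x : A) : quot_alg := \pi_(Quotient.quot ideal_zmod) x.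
Definition quot_repr (x : quot_alg) : A := generic_quotient.repr (x : Quotient.quot ideal_zmod).

Lemma quot_reprK : cancel quot_repr quot_pi.
Proof. by move=> x; rewrite /quot_pi /quot_repr reprK. Qed.

Lemma quot_piP x y : quot_pi x = quot_pi y <-> in_ideal (x - y).
Proof.
split=> [/eqP|/ideal_genP]; rewrite ?[_ == _]Quotient.idealrBE => h.
  by apply/ideal_genP; rewrite (Quotient.idealrBE ideal_zmod).
by apply/eqP; rewrite /quot_pi -(Quotient.idealrBE ideal_zmod).
Qed.

Lemma quot_pi0 : quot_pi 0 = 0.
Proof. exact: raddf0. Qed.

Lemma quot_piD x y : quot_pi (x + y) = quot_pi x + quot_pi y.
Proof. exact: raddfD. Qed.

Definition quot_one : quot_alg := quot_pi 1.
Definition quot_mul (x y : quot_alg) := quot_pi (quot_repr x * quot_repr y).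
Definition quot_scale (a : R) (x : quot_alg) := quot_pi (a *: quot_repr x).

Lemma quot_repr_pi x : in_ideal (quot_repr (quot_pi x) - x).
Proof. by apply/quot_piP; rewrite quot_reprK. Qed.

Lemma quot_mulE x y : quot_mul (quot_pi x) (quot_pi y) = quot_pi (x * y).
Proof.
apply/quot_piP; set x' := quot_repr _; set y' := quot_repr _.
have -> : x' * y' - x * y = 1 * (x' - x) * y' + x * (y' - y) * 1.
  by rewrite mul1r mulr1 mulrBl mulrBr addrA subrK.
by apply: in_idealD; apply: in_idealM; apply: quot_repr_pi.
Qed.

Lemma quot_scaleE a x : quot_scale a (quot_pi x) = quot_pi (a *: x).
Proof.
apply/quot_piP; rewrite -scalerBr -[X in a *: X]mul1r scalerAl.
by rewrite -[X in in_ideal X]mulr1; apply/in_idealM/quot_repr_pi.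
Qed.

Lemma quot_mulA : associative quot_mul.
Proof.
move=> x y z; rewrite -[x]quot_reprK -[y]quot_reprK -[z]quot_reprK.
by rewrite !quot_mulE mulrA.
Qed.

Lemma quot_mul1l : left_id quot_one quot_mul.
Proof. by move=> x; rewrite -[x]quot_reprK quot_mulE mul1r. Qed.

Lemma quot_mul1r : right_id quot_one quot_mul.
Proof. by move=> x; rewrite -[x]quot_reprK quot_mulE mulr1. Qed.

Lemma quot_mulDl : left_distributive quot_mul +%R.
Proof.
move=> x y z; rewrite -[x]quot_reprK -[y]quot_reprK -[z]quot_reprK.
by rewrite -quot_piD !quot_mulE -quot_piD mulrDl.
Qed.

Lemma quot_mulDr : right_distributive quot_mul +%R.
Proof.
move=> x y z; rewrite -[x]quot_reprK -[y]quot_reprK -[z]quot_reprK.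
by rewrite -quot_piD !quot_mulE -quot_piD mulrDr.
Qed.

HB.instance Definition _ := GRing.Zmodule_isPzRing.Build quot_alg
  quot_mulA quot_mul1l quot_mul1r quot_mulDl quot_mulDr.

Lemma quot_scaleA a b x : quot_scale a (quot_scale b x) = quot_scale (a * b) x.
Proof. by rewrite -[x]quot_reprK !quot_scaleE scalerA. Qed.

Lemma quot_scale1 : left_id 1 quot_scale.
Proof. by move=> x; rewrite -[x]quot_reprK quot_scaleE scale1r. Qed.

Lemma quot_scaleDr : right_distributive quot_scale +%R.
Proof.
move=> a x y; rewrite -[x]quot_reprK -[y]quot_reprK -quot_piD !quot_scaleE.
by rewrite -quot_piD scalerDr.
Qed.

Lemma quot_scaleDl x : {morph quot_scale^~ x : a b / a + b}.
Proof.
by move=> a b; rewrite -[x]quot_reprK !quot_scaleE -quot_piD scalerDl.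
Qed.

HB.instance Definition _ := GRing.Zmodule_isLmodule.Build R quot_alg
  quot_scaleA quot_scale1 quot_scaleDr quot_scaleDl.

Lemma quot_piM x y : quot_pi (x * y) = quot_pi x * quot_pi y.
Proof. by rewrite -quot_mulE. Qed.

Lemma quot_piZ a x : quot_pi (a *: x) = a *: quot_pi x.
Proof. by rewrite -quot_scaleE. Qed.

Lemma quot_scaleAl (a : R) (x y : quot_alg) : a *: (x * y) = (a *: x) * y.
Proof.
rewrite -[x]quot_reprK -[y]quot_reprK.
by rewrite -quot_piM -!quot_piZ -quot_piM scalerAl.
Qed.

Lemma quot_scaleAr (a : R) (x y : quot_alg) : a *: (x * y) = x * (a *: y).
Proof.
rewrite -[x]quot_reprK -[y]quot_reprK.
by rewrite -quot_piM -!quot_piZ -quot_piM scalerAr.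
Qed.

Lemma quot_pi_linear : linear quot_pi.
Proof. by move=> a x y; rewrite quot_piD quot_piZ. Qed.

Lemma quot_pi_monoid_morphism : monoid_morphism quot_pi.
Proof. by split=> // x y; rewrite quot_piM. Qed.

HB.instance Definition _ := GRing.isLinear.Build R A quot_alg _ quot_pi
  quot_pi_linear.
HB.instance Definition _ := GRing.isMonoidMorphism.Build A quot_alg quot_pi
  quot_pi_monoid_morphism.

End IdealQuotient.

Section FreeAlgebra.
Variables (k : fieldType) (X : choiceType).

(* k<X>: k-linear combinations of words in the alphabet X *)
Definition free_alg : Type := {malg k[{fmonom X}]}.

HB.instance Definition _ := GRing.Lalgebra.on free_alg.

Lemma free_scalerAr (a : k) (x y : free_alg) : a *: (x * y) = x * (a *: y).
Proof.
have comm_a : a%:MP * x = x * a%:MP.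
  rewrite [x in LHS]monalgE [x in RHS]monalgE mulr_sumr mulr_suml.
  by apply: eq_bigr => m _; rewrite !malgM_def !fgmulUU mul1m mulm1 mulrC.
by rewrite -[a *: y]mul_malgC mulrA -comm_a -mulrA mul_malgC.
Qed.

HB.instance Definition _ := GRing.Lalgebra_isAlgebra.Build k free_alg
  free_scalerAr.

Definition free_gen (x : X) : free_alg := << fmu x >>.

Lemma free_eq (B : lalgType k) (f g : {lrmorphism free_alg -> B}) :
  (forall x, f (free_gen x) = g (free_gen x)) -> f =1 g.
Proof.
move=> fg z; rewrite [z]monalgE !raddf_sum; apply: eq_bigr => m _ /=.
have -> : << z@_m *g m >> = z@_m *: (<< m >> : free_alg).
  by apply/malgP=> m'; rewrite mcoeffZ !mcoeffU mulrnAr mulr1.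
rewrite !linearZ; congr (_ *: _); case: m => s; elim: s => [|x s IHs] /=.
  have -> : << FMonom [::] >> = 1 :> free_alg by rewrite -fmoneE.
  by rewrite !rmorph1.
have -> : << FMonom (x :: s) >> = free_gen x * << FMonom s >> :> free_alg.
  rewrite malgM_def fgmulUU mulr1; congr << _ >>.
  by apply/eqP; rewrite fmP fmM fmU.
by rewrite !rmorphM /= fg IHs.
Qed.

Section Lift.
Variables (B : algType k) (f : X -> B).

Definition word_lift (m : {fmonom X}) : B := \prod_(x <- m) f x.

Lemma word_lift_morphism : mmorphism word_lift.
Proof.
split=> [m1 m2|]; first by rewrite /word_lift fmM big_cat.
by rewrite /word_lift fm1 big_nil.
Qed.

HB.instance Definition _ := isMultiplicative.Build _ _ word_lift
  word_lift_morphism.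

Definition free_lift : free_alg -> B := mmap (in_alg B) word_lift.

Lemma free_lift_linear : linear free_lift.
Proof.
move=> a x y; rewrite /free_lift raddfD /= mmapZ /=.
by rewrite mulr_algl.
Qed.

Lemma free_lift_monoid_morphism : monoid_morphism free_lift.
Proof.
have [fM f1] : multiplicative free_lift; last by split.
apply: commr_mmap_is_multiplicative => x m m' /=.
by rewrite /GRing.comm mulr_algl mulr_algr.
Qed.

HB.instance Definition _ := GRing.isLinear.Build k free_alg B _ free_lift
  free_lift_linear.
HB.instance Definition _ := GRing.isMonoidMorphism.Build free_alg B free_lift
  free_lift_monoid_morphism.

Lemma free_lift_gen x : free_lift (free_gen x) = f x.
Proof.
by rewrite /free_lift mmapU /= scale1r mul1r /word_lift fmU big_seq1.
Qed.

End Lift.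

End FreeAlgebra.

Section TensorAlgebra.
Variables (k : fieldType) (V : lmodType k).

Definition tensor_rel (x : free_alg k V) : Prop :=
  exists (a : k) (u v : V),
    x = free_gen k (a *: u + v) - (a *: free_gen k u + free_gen k v).

(* T(V), the free algebra on V modulo linearity of the generators *)
Definition tensor_alg : Type := quot_alg tensor_rel.

HB.instance Definition _ := GRing.PzRing.on tensor_alg.
HB.instance Definition _ := GRing.Lmodule.on tensor_alg.

Lemma tensor_oner_neq0 : 1 != 0 :> tensor_alg.
Proof.
apply/eqP => one0; have /quot_piP : quot_pi tensor_rel 1 = quot_pi tensor_rel 0.
  by rewrite rmorph0 rmorph1.
rewrite subr0 => I1.
suff aug (x : free_alg k V) : in_ideal tensor_rel x ->
    mcoeff (mone : {fmonom V}) (x : {malg k[{fmonom V}]}) = 0.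
  by move/aug/eqP: I1; rewrite mcoeff1 eqxx oner_eq0.
have cM (y z : {malg k[{fmonom V}]}) : (y * z)@_mone = y@_mone * z@_mone :=
  rmorphM (mcoeff mone) y z.
elim=> {x}[x [a [u [v ->]]]||x y _ x0 _ y0|a x b _ x0].
- by rewrite !mcoeffsE !fm1_eq1 !mulr0n mulr0 addr0 subr0.
- exact: mcoeff0.
- by rewrite mcoeffD x0 y0 addr0.
by rewrite [LHS]cM [X in X * _]cM x0 mulr0 mul0r.
Qed.

HB.instance Definition _ := GRing.PzSemiRing_isNonZero.Build tensor_alg
  tensor_oner_neq0.
HB.instance Definition _ := GRing.Lmodule_isLalgebra.Build k tensor_alg
  (@quot_scaleAl _ _ tensor_rel).
HB.instance Definition _ := GRing.Lalgebra_isAlgebra.Build k tensor_alg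
  (@quot_scaleAr _ _ tensor_rel).

Definition tensor_inj (v : V) : tensor_alg := quot_pi tensor_rel (free_gen k v).

Lemma tensor_inj_linear : linear tensor_inj.
Proof.
move=> a u v; rewrite /tensor_inj -linearP; apply/quot_piP/in_ideal_gen.
by exists a, u, v.
Qed.

HB.instance Definition _ := GRing.isLinear.Build k V tensor_alg _ tensor_inj
  tensor_inj_linear.

Section Lift.
Variables (B : algType k) (f : {linear V -> B}).

Definition tensor_lift (x : tensor_alg) : B := free_lift f (quot_repr x).

Lemma tensor_liftE x : tensor_lift (quot_pi tensor_rel x) = free_lift f x.
Proof.
apply/eqP; rewrite -subr_eq0 -rmorphB /=; apply/eqP.
elim: (quot_repr_pi tensor_rel x) => {x} [x [a [u [v ->]]]||x y _ x0 _ y0|].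
- by rewrite linearB linearP /= !free_lift_gen linearP subrr.
- exact: rmorph0.
- by rewrite rmorphD /= x0 y0 addr0.
by move=> a x b _ x0; rewrite !rmorphM /= x0 mulr0 mul0r.
Qed.

Lemma tensor_lift_linear : linear tensor_lift.
Proof.
move=> a x y; rewrite -[x]quot_reprK -[y]quot_reprK -linearP.
by rewrite !tensor_liftE linearP.
Qed.

Lemma tensor_lift_monoid_morphism : monoid_morphism tensor_lift.
Proof.
split=> [|x y]; first by rewrite tensor_liftE rmorph1.
rewrite -[x]quot_reprK -[y]quot_reprK -rmorphM.
by rewrite !tensor_liftE rmorphM.
Qed.

HB.instance Definition _ := GRing.isLinear.Build k tensor_alg B _ tensor_lift
  tensor_lift_linear.
HB.instance Definition _ := GRing.isMonoidMorphism.Build tensor_alg B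
  tensor_lift tensor_lift_monoid_morphism.

Lemma tensor_lift_inj v : tensor_lift (tensor_inj v) = f v.
Proof. by rewrite tensor_liftE free_lift_gen. Qed.

End Lift.

Lemma tensor_eq (B : lalgType k) (f g : {lrmorphism tensor_alg -> B}) :
  (forall v, f (tensor_inj v) = g (tensor_inj v)) -> f =1 g.
Proof.
move=> fg x; rewrite -[x]quot_reprK.
by apply: (@free_eq _ _ _ (f \o quot_pi tensor_rel) (g \o quot_pi tensor_rel)).
Qed.

End TensorAlgebra.

Section SkewGroupAlgebra.
Variables (k : fieldType) (gT : finGroupType) (A : algType k).

Record alg_action := AlgAction {
  alg_act :> gT -> {lrmorphism A -> A};
  alg_act1 : forall a, alg_act 1%g a = a;
  alg_actM : forall g h a, alg_act (g * h)%g a = alg_act g (alg_act h a)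
}.

(* A * gT; the function f stands for the formal sum of the (f g) g, and the    *)
(* product is determined by (a g) (b h) = (a (phi g b)) (g h), see skew_elemM. *)
Definition skew_alg (phi : alg_action) : Type := {ffun gT -> A}.

Variable phi : alg_action.
Local Notation skew := (skew_alg phi).

HB.instance Definition _ := GRing.Lmodule.copy skew {ffun gT -> A}.

Definition skew_elem (a : A) (g : gT) : skew :=
  [ffun x => if x == g then a else 0].

Definition skew_mul (f1 f2 : skew) : skew :=
  [ffun x => \sum_(g : gT) f1 g * phi g (f2 (g^-1 * x)%g)].

Lemma skew_mulA : associative skew_mul.
Proof.
move=> f1 f2 f3; apply/ffunP => x; rewrite !ffunE.
transitivity (\sum_g \sum_h f1 g * (phi g (f2 h) *
    phi (g * h)%g (f3 (h^-1 * (g^-1 * x))%g))).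
  apply: eq_bigr => g _; rewrite ffunE raddf_sum mulr_sumr.
  by apply: eq_bigr => h _; rewrite /= rmorphM alg_actM.
rewrite exchange_big /=; under [RHS]eq_bigr => g _ do rewrite ffunE mulr_suml.
rewrite exchange_big [RHS]exchange_big /=; apply: eq_bigr => g _.
rewrite [RHS](reindex_inj (mulgI g)) /=; apply: eq_bigr => h _.
by rewrite mulKg invMg !mulgA mulrA.
Qed.

Lemma skew_mul1l : left_id (skew_elem 1 1%g) skew_mul.
Proof.
move=> f; apply/ffunP => x; rewrite ffunE (bigD1 1%g) //= big1 => [|g /negPf g1].
  by rewrite ffunE eqxx mul1r alg_act1 invg1 mul1g addr0.
by rewrite ffunE g1 mul0r.
Qed.

Lemma skew_mul1r : right_id (skew_elem 1 1%g) skew_mul.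
Proof.
move=> f; apply/ffunP => x; rewrite ffunE (bigD1 x) //= big1 => [|g gx].
  by rewrite ffunE mulVg eqxx rmorph1 mulr1 addr0.
by rewrite ffunE -eq_mulVg1 (negPf gx) raddf0 mulr0.
Qed.

Lemma skew_mulDl : left_distributive skew_mul +%R.
Proof.
move=> f1 f2 f; apply/ffunP => x; rewrite !ffunE -big_split /=.
by apply: eq_bigr => g _; rewrite ffunE mulrDl.
Qed.

Lemma skew_mulDr : right_distributive skew_mul +%R.
Proof.
move=> f f1 f2; apply/ffunP => x; rewrite !ffunE -big_split /=.
by apply: eq_bigr => g _; rewrite ffunE raddfD mulrDr.
Qed.

Lemma skew_oner_neq0 : skew_elem 1 1%g != 0.
Proof.
by apply/eqP=> /ffunP/(_ 1%g)/eqP; rewrite !ffunE eqxx oner_eq0.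
Qed.

HB.instance Definition _ := GRing.Zmodule_isNzRing.Build skew
  skew_mulA skew_mul1l skew_mul1r skew_mulDl skew_mulDr skew_oner_neq0.

Lemma skew_scaleAl (c : k) (f1 f2 : skew) : c *: (f1 * f2) = (c *: f1) * f2.
Proof.
apply/ffunP => x; rewrite !ffunE scaler_sumr.
by apply: eq_bigr => g _; rewrite ffunE scalerAl.
Qed.

Lemma skew_scaleAr (c : k) (f1 f2 : skew) : c *: (f1 * f2) = f1 * (c *: f2).
Proof.
apply/ffunP => x; rewrite !ffunE scaler_sumr.
by apply: eq_bigr => g _; rewrite ffunE linearZ scalerAr.
Qed.

HB.instance Definition _ := GRing.Lmodule_isLalgebra.Build k skew
  skew_scaleAl.
HB.instance Definition _ := GRing.Lalgebra_isAlgebra.Build k skew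
  skew_scaleAr.

Lemma skew_elemM a g b h :
  skew_elem a g * skew_elem b h = skew_elem (a * phi g b) (g * h)%g.
Proof.
apply/ffunP => x; rewrite !ffunE (bigD1 g) //= big1 => [|i /negPf ig].
  rewrite !ffunE eqxx addr0 (can2_eq (mulKVg g) (mulKg g)).
  by case: ifP => // _; rewrite raddf0 mulr0.
by rewrite ffunE ig mul0r.
Qed.

End SkewGroupAlgebra.

Definition centre (A : pzRingType) (z : A) : Prop := forall x, z * x = x * z.

Record idem_elt (A : pzRingType) := IdemElt {
  idem_val :> A;
  idem_valK : idem_val * idem_val = idem_val
}.

Section Corner.
Variables (k : nzRingType) (A : algType k) (X : A -> Prop).
Local Notation H := (quot_alg X).
Variable ee : idem_elt H.
Local Notation e := (idem_val ee).

(* eHe; its unit, corner_one below, is e *)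
Definition in_corner : pred H := fun x => `[< exists u, x = e * u * e >].

Lemma in_cornerP x : reflect (exists u, x = e * u * e) (x \in in_corner).
Proof. exact: asboolP. Qed.

Lemma in_corner_proj u : e * u * e \in in_corner.
Proof. by apply/in_cornerP; exists u. Qed.

Lemma in_cornerl x : x \in in_corner -> e * x = x.
Proof. by case/in_cornerP => u ->; rewrite !mulrA idem_valK. Qed.

Lemma in_cornerr x : x \in in_corner -> x * e = x.
Proof. by case/in_cornerP => u ->; rewrite -!mulrA idem_valK. Qed.

Lemma in_corner_zmod_closed : zmod_closed in_corner.
Proof.
split=> [|x y /in_cornerP[u ->] /in_cornerP[v ->]].
  by apply/in_cornerP; exists 0; rewrite mulr0 mul0r.
by rewrite -mulrBl -mulrBr in_corner_proj.
Qed.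

HB.instance Definition _ := GRing.isZmodClosed.Build H in_corner
  in_corner_zmod_closed.

Record corner := Corner { corner_val : H; _ : corner_val \in in_corner }.

HB.instance Definition _ := [isSub for corner_val].
HB.instance Definition _ := [Choice of corner by <:].
HB.instance Definition _ := [SubChoice_isSubZmodule of corner by <:].

Definition corner_proj (u : H) : corner := Corner (in_corner_proj u).

Lemma corner_one_subproof : e \in in_corner.
Proof. by apply/in_cornerP; exists 1; rewrite mulr1 idem_valK. Qed.

Lemma corner_mul_subproof (x y : corner) :
  corner_val x * corner_val y \in in_corner.
Proof.
rewrite -(in_cornerl (valP x)) -(in_cornerr (valP y)).
by rewrite mulrA -[X in X * e]mulrA in_corner_proj.
Qed.

Lemma corner_scale_subproof (a : k) (x : corner) :
  a *: corner_val x \in in_corner.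
Proof.
rewrite -(in_cornerl (valP x)) -[X in _ * X](in_cornerr (valP x)).
by rewrite quot_scaleAr quot_scaleAl mulrA in_corner_proj.
Qed.

Definition corner_one : corner := Corner corner_one_subproof.
Definition corner_mul (x y : corner) : corner := Corner (corner_mul_subproof x y).
Definition corner_scale (a : k) (x : corner) : corner :=
  Corner (corner_scale_subproof a x).

Lemma corner_mulA : associative corner_mul.
Proof. by move=> x y z; apply: val_inj; rewrite /= mulrA. Qed.

Lemma corner_mul1l : left_id corner_one corner_mul.
Proof. by move=> x; apply: val_inj; rewrite /= in_cornerl ?(valP x). Qed.

Lemma corner_mul1r : right_id corner_one corner_mul.
Proof. by move=> x; apply: val_inj; rewrite /= in_cornerr ?(valP x). Qed.

Lemma corner_mulDl : left_distributive corner_mul +%R.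
Proof. by move=> x y z; apply: val_inj; rewrite /= mulrDl. Qed.

Lemma corner_mulDr : right_distributive corner_mul +%R.
Proof. by move=> x y z; apply: val_inj; rewrite /= mulrDr. Qed.

HB.instance Definition _ := GRing.Zmodule_isPzRing.Build corner
  corner_mulA corner_mul1l corner_mul1r corner_mulDl corner_mulDr.

Lemma corner_scaleA a b x :
  corner_scale a (corner_scale b x) = corner_scale (a * b) x.
Proof. by apply: val_inj; rewrite /= scalerA. Qed.

Lemma corner_scale1 : left_id 1 corner_scale.
Proof. by move=> x; apply: val_inj; rewrite /= scale1r. Qed.

Lemma corner_scaleDr : right_distributive corner_scale +%R.
Proof. by move=> a x y; apply: val_inj; rewrite /= scalerDr. Qed.

Lemma corner_scaleDl x : {morph corner_scale^~ x : a b / a + b}.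
Proof. by move=> a b; apply: val_inj; rewrite /= scalerDl. Qed.

HB.instance Definition _ := GRing.Zmodule_isLmodule.Build k corner
  corner_scaleA corner_scale1 corner_scaleDr corner_scaleDl.

Lemma corner_scaleAl (a : k) (x y : corner) : a *: (x * y) = (a *: x) * y.
Proof. by apply: val_inj; rewrite /= quot_scaleAl. Qed.

Lemma corner_scaleAr (a : k) (x y : corner) : a *: (x * y) = x * (a *: y).
Proof. by apply: val_inj; rewrite /= quot_scaleAr. Qed.

End Corner.

Section SymplecticReflectionAlgebra.
Variables (k : fieldType) (V : vectType k) (gT : finGroupType).

Record linear_action := LinearAction {
  lin_act :> gT -> 'End(V);
  lin_act1 : lin_act 1%g = \1%VF;
  lin_actM : forall g h, lin_act (g * h)%g = (lin_act g \o lin_act h)%VF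
}.

Variable rho : linear_action.

Definition tensor_act (g : gT) : {lrmorphism tensor_alg V -> tensor_alg V} :=
  tensor_lift (@tensor_inj k V \o rho g).

Lemma tensor_act_inj g v : tensor_act g (tensor_inj v) = tensor_inj (rho g v).
Proof. exact: tensor_lift_inj. Qed.

Lemma tensor_act1 x : tensor_act 1%g x = x.
Proof.
move: x; apply: (@tensor_eq _ _ _ _ idfun) => v.
by rewrite tensor_act_inj lin_act1 id_lfunE.
Qed.

Lemma tensor_actM g h x : tensor_act (g * h)%g x = tensor_act g (tensor_act h x).
Proof.
move: x; apply: (@tensor_eq _ _ _ _ (tensor_act g \o tensor_act h)) => v /=.
by rewrite !tensor_act_inj lin_actM comp_lfunE.
Qed.

Definition tensor_action := AlgAction tensor_act1 tensor_actM.

Definition tensor_skew_alg : algType k := skew_alg tensor_action.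

Definition skew_vect (v : V) : tensor_skew_alg :=
  skew_elem tensor_action (tensor_inj v) 1%g.
Definition skew_group (g : gT) : tensor_skew_alg := skew_elem tensor_action 1 g.

Definition sympl_refl : {set gT} :=
  [set s | \dim (limg (\1 - rho s)%VF) == 2%N].

Variable omega : V -> V -> k.

(* If V is the direct sum of im(Id - s) and ker(Id - s), e.g. if |gT| != 0 in   *)
(* k, this is the skew-symmetric form that has ker(Id - s) in its radical and  *)
(* coincides with omega on im(Id - s); see refl_formP.                         *)
Definition refl_form (s : gT) (x y : V) : k :=
  let pr := daddv_pi (limg (\1 - rho s)%VF) (lker (\1 - rho s)%VF) in
  omega (pr x) (pr y).

Variable c : gT -> k.

Definition sra_rel (z : tensor_skew_alg) : Prop :=
  exists x y : V,
    z = (skew_vect x * skew_vect y - skew_vect y * skew_vect x)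
        - (omega x y *: skew_group 1%g
           - \sum_(s in sympl_refl) (c s * refl_form s x y) *: skew_group s).

(* H_{1,c}(V, omega, gT); only the values of c on sympl_refl matter *)
Definition sra : Type := quot_alg sra_rel.

HB.instance Definition _ := GRing.PzRing.on sra.
HB.instance Definition _ := GRing.Lmodule.on sra.

Definition sra_group (g : gT) : sra := quot_pi sra_rel (skew_group g).

Lemma sra_groupM g h : sra_group (g * h) = sra_group g * sra_group h.
Proof. by rewrite /sra_group -quot_piM skew_elemM rmorph1 mulr1. Qed.

(* As 0^-1 = 0, this is idempotent (namely 0) also when |gT| = 0 in k. *)
Definition sra_average : sra := (#|gT|%:R^-1 : k) *: \sum_(g : gT) sra_group g.

Lemma sra_averageK : sra_average * sra_average = sra_average.
Proof.
rewrite /sra_average -quot_scaleAl -quot_scaleAr scalerA mulr_suml.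
have shift g : sra_group g * \sum_h sra_group h = \sum_h sra_group h.
  rewrite mulr_sumr [RHS](reindex_inj (mulgI g)).
  by apply: eq_bigr => h _; rewrite sra_groupM.
rewrite (eq_bigr _ (fun g _ => shift g)).
rewrite sumr_const -scaler_nat scalerA; congr (_ *: _).
have [->|n0] := eqVneq (#|gT|%:R : k) 0; first by rewrite mulr0 invr0.
by rewrite mulfVK.
Qed.

Definition sra_e : idem_elt sra := IdemElt sra_averageK.

End SymplecticReflectionAlgebra.

Section ReflForm.
Variables (k : fieldType) (V : vectType k) (gT : finGroupType).
Variables (rho : linear_action V gT) (omega : {skew_symmetric V}).
Hypothesis gT_neq0 : #|gT|%:R != 0 :> k.

Local Notation im s := (limg (\1 - rho s)%VF).
Local Notation ker s := (lker (\1 - rho s)%VF).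

Lemma cap_im_ker s : (im s :&: ker s = 0)%VS.
Proof.
apply/eqP; rewrite -subv0; apply/subvP => u /memv_capP[/memv_imgP[v _ def_u]].
rewrite memv_ker !lfunE /= id_lfunE !lfunE /= subr_eq0 => /eqP u_fix.
have rho_v n : rho (s ^+ n)%g v = v - u *+ n.
  elim: n => [|n IHn]; first by rewrite expg0 lin_act1 id_lfunE subr0.
  rewrite expgS lin_actM comp_lfunE IHn linearB raddfMn /= -u_fix.
  have -> : rho s v = v - u by rewrite def_u !lfunE /= !lfunE /= subKr.
  by rewrite mulrS opprD addrA.
have s_card : (s ^+ #|gT| = 1)%g.
  by rewrite -cardsT expg_cardG ?inE.
have := rho_v #|gT|; rewrite s_card lin_act1 id_lfunE.
move/eqP; rewrite eq_sym -subr_eq0 addrAC subrr sub0r oppr_eq0 -scaler_nat.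
by rewrite scaler_eq0 (negPf gT_neq0) memv0.
Qed.

Lemma add_im_ker s : (im s + ker s = fullv)%VS.
Proof.
apply/eqP; rewrite eqEdim subvf /= dimv_disjoint_sum ?cap_im_ker //.
by rewrite addnC -(limg_ker_dim (\1 - rho s)%VF fullv) capfv.
Qed.

Lemma refl_form_skew_symmetric s :
  exists w : {skew_symmetric V}, refl_form rho omega s =2 w.
Proof.
pose pr := daddv_pi (im s) (ker s).
pose w x y := omega (pr x) (pr y).
have wB : bilinear_for *%R (idfun \; *%R) w.
  by split=> [y|x] a u v; rewrite /w linearP ?linearPl ?linearPr.
have wS x y : w x y = (-1) ^+ true * idfun (w y x).
  exact: hermitian_subproof.
pose wI := bilinear_isBilinear.Build _ _ _ _ _ _ w wB.
pose wJ := isHermitianSesquilinear.Build _ _ true idfun w wS.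
pose wT : {skew_symmetric V} := HB.pack w wI wJ.
by exists wT.
Qed.

Lemma refl_formP s :
  [/\ forall x y, x \in ker s -> refl_form rho omega s x y = 0,
      {in im s &, refl_form rho omega s =2 omega}
    & forall w : {skew_symmetric V},
        (forall x y, x \in ker s -> w x y = 0) -> {in im s &, w =2 omega} ->
        w =2 refl_form rho omega s].
Proof.
have cap0 := cap_im_ker s; set pr := daddv_pi (im s) (ker s).
have pr_im x : pr x \in im s by apply: memv_pi.
have split_x x : exists2 y, y \in ker s & x = pr x + y.
  exists (daddv_pi (ker s) (im s) x); first exact: memv_pi.
  by rewrite daddv_pi_add // add_im_ker memvf.
split=> [x y x_ker|x y x_im y_im|w w_ker w_im x y].
- rewrite /refl_form -/pr; have -> : pr x = 0; last by rewrite linear0l.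
  apply/eqP; rewrite -memv0 -cap0 memv_cap pr_im /=.
  have [z z_ker def_x] := split_x x.
  by rewrite -[pr x](addrK z) -def_x rpredB.
- by rewrite /refl_form !daddv_pi_id.
have [x' x'_ker def_x] := split_x x; have [y' y'_ker def_y] := split_x y.
have w_kerr u v : v \in ker s -> w u v = 0.
  by move=> v_ker; rewrite hermitian_subproof w_ker // mulr0.
rewrite [in LHS]def_x [in LHS]def_y linearDl /= linearDr /= (w_ker x') //.
by rewrite (w_kerr _ y') // !addr0 w_im.
Qed.

End ReflForm.

(* Main.v *)
(* Write H for the symplectic reflection algebra, S for the polynomial ring on  *)
(* V and e for the averaging idempotent. The PBW theorem makes the associated   *)
(* graded ring of H the skew group ring S * Gamma. It is proved by rewriting    *)
(* words to sorted ones: the corrections picked up along insertion sort do not  *)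
(* depend on the order of the exchanges, because of the Jacobi identity for the *)
(* defining relations.                                                          *)
(*   As every nontrivial element of Gamma moves vectors in at least two         *)
(* directions, HeH contains two elements d1 and d2 whose symbols are coprime    *)
(* Gamma-invariant products D1, D2 of linear forms. An element z of the centre  *)
(* with ze = 0 kills HeH, in particular d1, and is therefore 0. Conversely let  *)
(* w be central in eHe. The relation between the sums of the a e b and of the   *)
(* a w b is the graph of an H-bimodule map f from HeH to H. The symbol of f(d1) *)
(* times D2 equals that of f(d2) times D1, hence is divisible by D1; lifting    *)
(* the quotient to H and subtracting its left multiplication from f lowers the  *)
(* degree of f. After finitely many steps f(d1) = z d1, which forces f to be    *)
(* the multiplication by z; then z is central and ze = f(e) = w.                *)

From HB Require Import structures.
Require Import Defs.
From mathcomp Require Import all_boot all_fingroup all_order all_algebra.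
From mathcomp Require Import classical_sets functions boolp.
From mathcomp Require Import ring zify.

Set Implicit Arguments.
Unset Strict Implicit.
Unset Printing Implicit Defensive.

Import GRing.Theory.

Local Open Scope ring_scope.

(** * Insertion sort and the diamond lemma *)

(** Filter [H] by degree in [V], and let [S] be the polynomial ring on [V]. By PBW the graded ring
    is the skew group ring of [Gamma] over [S]: [nf] sends a word to its monomial plus corrections
    collected while sorting, [nf_swapP] shows that it respects the defining relations, [from_nfK]
    recovers an element from its components, and [hnfM] computes top parts of products.

    On the centre [theta] sends z to z e, so it is multiplicative with central values; the work lies
    in bijectivity. Every t other than 1 moves two independent directions ([im_two_vectors]). Hence
    twisted commutators starting from e can remove the top components at all nontrivial group
    elements. By [iter_comm_symbolP], [transversal_vectors] and [moved_coprime] they give d1, d2 in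
    HeH whose top parts D1, D2 are invariant, coprime products of linear forms up to a scalar.
    Elements with such top parts are not zero divisors.

    Injectivity ([central_inj]): z e = 0 gives z d1 = 0, so z = 0. Surjectivity ([central_lift]):
    for w central in eHe, sending a e b to a w b defines a map f from HeH to H with x f(y) = f(x) y
    ([ideal_map_sym]). Were f multiplication by z, the top part of z would be that of f(d1) divided
    by D1. Now f(d1) d2 - f(d2) d1 = f(d1 d2 - d2 d1) has small degree, so coprimality makes this
    quotient a polynomial, and [descent_step] subtracts a lift of it from f, lowering the degree of
    f. Finitely many steps give f(d1) = z d1; cancelling d1 shows that f is multiplication by z,
    that z is central, and that z e = f(e) = w. *)

Section InsertionSort.
Variables (X : eqType) (le : rel X).
Hypotheses (le_total : total le) (le_trans : transitive le)
  (le_anti : antisymmetric le).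

Fixpoint insert (x : X) (u : seq X) : seq X :=
  if u is y :: u' then if le x y then x :: u else y :: insert x u' else [:: x].

Fixpoint isort (u : seq X) : seq X :=
  if u is x :: u' then insert x (isort u') else [::].

Lemma perm_insert x u : perm_eq (insert x u) (x :: u).
Proof.
elim: u => //= y u IHu; case: ifP => // _.
apply: (@perm_trans _ (y :: x :: u)); first by rewrite perm_cons.
apply/permPl; exact: (perm_catCA [:: y] [:: x] u).
Qed.

Lemma perm_isort u : perm_eq (isort u) u.
Proof.
elim: u => //= x u IHu; apply: (perm_trans (perm_insert x _)).
by rewrite perm_cons.
Qed.

Lemma insert_sorted x u : sorted le u -> sorted le (insert x u).
Proof.
elim: u => //= y u IHu sorted_yu; case: ifP => [xy|/negbT xy] /=.
  by rewrite xy.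
have yx : le y x by have := le_total x y; rewrite (negPf xy).
have le_y : all (le y) (insert x u).
  rewrite (perm_all _ (perm_insert x u)) /= yx.
  exact: order_path_min sorted_yu.
have := IHu (path_sorted sorted_yu).
by rewrite path_sortedE // le_y.
Qed.

Lemma isort_sorted u : sorted le (isort u).
Proof. by elim: u => //= x u; apply: insert_sorted. Qed.

Lemma insert_id x u : path le x u -> insert x u = x :: u.
Proof. by case: u => //= y u /andP[->]. Qed.

Lemma isort_id u : sorted le u -> isort u = u.
Proof.
elim: u => //= x u IHu path_xu; rewrite IHu ?insert_id //.
exact: path_sorted path_xu.
Qed.

Lemma eq_isort u v : perm_eq u v -> isort u = isort v.
Proof.
move=> uv; apply: (sorted_eq le_trans le_anti) => //; try exact: isort_sorted.
by rewrite (perm_trans (perm_isort u)) // perm_sym (perm_trans (perm_isort v))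
  // perm_sym.
Qed.

(** * Integrating prescribed exchange differences along insertion sort *)

Section Cost.
Variables (R : comNzRingType) (d : seq X -> X -> X -> seq X -> R).

(* [d a x y b] is the prescribed difference f (a ++ x :: y :: b) -             *)
(* f (a ++ y :: x :: b); the cost adds these up along insertion sort.          *)
Fixpoint insert_cost (a : seq X) (x : X) (u : seq X) : R :=
  if u is y :: u' then
    if le x y then 0 else d a x y u' + insert_cost (rcons a y) x u'
  else 0.

Fixpoint isort_cost (a u : seq X) : R :=
  if u is x :: u' then
    isort_cost (rcons a x) u' + insert_cost a x (isort u')
  else 0.

Lemma isort_cost_sorted a u : sorted le u -> isort_cost a u = 0.
Proof.
elim: u a => //= x u IHu a path_xu.
have u_sorted := path_sorted path_xu.
rewrite IHu // isort_id // add0r.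
by case: u path_xu {IHu u_sorted} => //= y u /andP[->].
Qed.

Variable n : nat.
Hypothesis d_anti : forall a x y b, (size a + size b).+2 = n ->
  d a x y b = - d a y x b.
Hypothesis d_diag : forall a x b, d a x x b = 0.
Hypothesis d_far : forall a x y b z t c,
  (size a + size b + size c).+4 = n ->
  d a x y (b ++ z :: t :: c) - d a x y (b ++ t :: z :: c) =
  d (a ++ x :: y :: b) z t c - d (a ++ y :: x :: b) z t c.
Hypothesis d_braid : forall a x y z c, (size a + size c).+3 = n ->
  d a x y (z :: c) + d (rcons a y) x z c + d a y z (x :: c) =
  d (rcons a x) y z c + d a x z (y :: c) + d (rcons a z) x y c.

Lemma insert_cost_far p x y a z u : (size p + size a + size u).+3 = n ->
  insert_cost (p ++ x :: y :: a) z u - insert_cost (p ++ y :: x :: a) z u =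
  d p x y (a ++ z :: u) - d p x y (a ++ insert z u).
Proof.
elim: u a => [|t u IHu] a /= sz; first by rewrite !subrr.
case: ifP => _; first by rewrite !subrr.
rewrite !rcons_cat !rcons_cons opprD addrACA IHu ?size_rcons; last by lia.
rewrite -d_far; last by lia.
by rewrite !cat_rcons subrKA.
Qed.

Lemma isort_cost_far p x y a u : (size p + size a + size u).+2 = n ->
  isort_cost (p ++ x :: y :: a) u - isort_cost (p ++ y :: x :: a) u =
  d p x y (a ++ u) - d p x y (a ++ isort u).
Proof.
elim: u a => [|z u IHu] a /= sz; first by rewrite !subrr.
rewrite !rcons_cat !rcons_cons opprD addrACA IHu ?size_rcons; last by lia.
rewrite insert_cost_far ?(perm_size (perm_isort u)); last by lia.
by rewrite !cat_rcons subrKA.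
Qed.

(** Inserting two letters in either order. By induction on [u], only a head [z] smaller than both
    letters needs [d_braid]; [insert_cost_far] then reorders the prefix. *)
Lemma insert_cost_braid p x y u : sorted le u -> (size p + size u).+2 = n ->
  insert_cost (rcons p x) y u + insert_cost p x (insert y u)
  - (insert_cost (rcons p y) x u + insert_cost p y (insert x u))
  = d p x y u.
Proof.
(* Both sides change sign when [x] and [y] are exchanged, by [d_anti]. *)
wlog lt_xy : x y / (x == y) || ~~ le y x => [th|].
  case/orP: (le_total x y) => h.
    have [<-|ne] := eqVneq x y; first by apply: th; rewrite eqxx.
    apply: th; apply/orP; right; apply: contraNN ne => h'.
    by apply/eqP/le_anti/andP.
  move=> u_sorted sz; have [->|ne] := eqVneq x y.
    by rewrite subrr d_diag.
  rewrite d_anti // -th ?opprB //.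
  apply/orP; right; apply: contraNN ne => h'.
  by apply/eqP/le_anti/andP.
case/orP: lt_xy => [/eqP <-|nyx]; first by rewrite subrr d_diag.
have xy : le x y by have := le_total x y; rewrite (negPf nyx) orbF.
elim: u p => [|z u IHu] p /=.
  by rewrite xy (negPf nyx) => _ sz; rewrite (d_anti x y) //; ring.
move=> path_zu sz; have u_sorted := path_sorted path_zu.
have [yz|zy] := boolP (le y z).
  rewrite (le_trans xy yz) /= xy (negPf nyx) yz.
  by rewrite (d_anti x y) //=; ring.
case: (boolP (le x z)) => [xz|zx] /=.
  by rewrite xz (negPf nyx) (negPf zy) (d_anti x y) //=; ring.
rewrite (negPf zy) (negPf zx).
have IH := IHu (rcons p z) u_sorted; rewrite size_rcons in IH.
have {}IH := IH ltac:(lia).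
have farx := @insert_cost_far p x z [::] y u ltac:(move: sz => /=; lia).
have fary := @insert_cost_far p y z [::] x u ltac:(move: sz => /=; lia).
rewrite /= -!cats1 -!catA /= in farx fary IH *.
have braid := @d_braid p x y z u ltac:(move: sz => /=; lia).
rewrite -!cats1 in braid.
set A := insert_cost _ x (insert y u) in IH *.
set B := insert_cost _ y (insert x u) in IH *.
set A1 := insert_cost _ y u in IH farx *; set A2 := insert_cost _ y u in farx *.
set B1 := insert_cost _ x u in IH fary *; set B2 := insert_cost _ x u in fary *.
rewrite -[A2](subrK A1) farx -[B2](subrK B1) fary.
(* The braid relation solved for the wanted term; what remains is the induction hypothesis with
   prefix [rcons p z]. *)
have -> : d p x y (z :: u) = d (p ++ [:: x]) y z u + d p x z (y :: u)
    + d (p ++ [:: z]) x y u - d (p ++ [:: y]) x z u - d p y z (x :: u).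
  by rewrite -braid; ring.
by rewrite -IH; ring.
Qed.

Lemma isort_cost_closed (P : R -> Prop) p u :
  P 0 -> (forall x y, P x -> P y -> P (x + y)) ->
  (forall a x y b, (size a + size b).+2 = n -> P (d a x y b)) ->
  (size p + size u)%N = n -> P (isort_cost p u).
Proof.
move=> P0 PD Pd.
have Pins q x v : (size q + size v).+1 = n -> P (insert_cost q x v).
  elim: v q => //= y v IHv q sz; case: ifP => // _.
  by apply: PD; [apply: Pd | apply: IHv; rewrite size_rcons]; lia.
elim: u p => //= x u IHu p sz; apply: PD.
  by apply: IHu; rewrite size_rcons; lia.
by apply: Pins; rewrite (perm_size (perm_isort u)); lia.
Qed.

(** [d_far] and [d_braid] say that [d] is closed along the squares and hexagons of adjacent
    transpositions; the sorting cost is a potential for it. A first letter of [a] is inserted at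
    equal cost on both sides, because the sorted tails agree. *)
Lemma isort_cost_swap p a x y b : (size p + size a + size b).+2 = n ->
  isort_cost p (a ++ x :: y :: b) - isort_cost p (a ++ y :: x :: b)
  = d (p ++ a) x y b.
Proof.
elim: a p => [|z a IHa] p /= sz.
  have braid := @insert_cost_braid p x y (isort b) (isort_sorted b).
  rewrite (perm_size (perm_isort b)) addn0 in braid sz.
  have {}braid := braid sz.
  have far := @isort_cost_far p x y [::] b ltac:(by rewrite addn0).
  rewrite /= -!cats1 -!catA /= in far braid *; rewrite cats0.
  rewrite -[isort_cost (p ++ [:: x; y]) b](subrK (isort_cost (p ++ [:: y; x]) b)).
  by rewrite far -braid; ring.
have -> : isort (a ++ x :: y :: b) = isort (a ++ y :: x :: b).
  apply: eq_isort; rewrite perm_cat2l; apply/permPl.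
  exact: (perm_catCA [:: x] [:: y] b).
rewrite opprD addrACA subrr addr0 IHa ?size_rcons ?cat_rcons //; lia.
Qed.

End Cost.
End InsertionSort.

(** * Words in the tensor and skew group algebras *)

(* The module keeps the notations of monalg apart from those of mpoly. *)
Module TensorWords.
From mathcomp Require Import finmap monalg.

Lemma mulr_regroup (A : pzRingType) (x a z b y : A) :
  x * (a * z * b) * y = (x * a) * z * (b * y).
Proof. by rewrite !mulrA. Qed.

Lemma mulr_relation (k : fieldType) (A : algType k) (I : finType) (a b p q : A)
    (f : I -> k) (w : I -> A) :
  a * (p - q - \sum_i f i *: w i) * b
  = a * p * b - a * q * b - \sum_i f i *: (a * w i * b).
Proof.
rewrite !mulrBr !mulrBl mulr_sumr mulr_suml; congr (_ - _).
by apply: eq_bigr => i _; rewrite -scalerAr -scalerAl.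
Qed.

Lemma linear_relation (k : fieldType) (U W : lmodType k) (g : {linear U -> W})
    (I : finType) (p q : U) (f : I -> k) (w : I -> U) :
  g (p - q - \sum_i f i *: w i) = g p - g q - \sum_i f i *: g (w i).
Proof.
rewrite !raddfB raddf_sum; congr (_ - _); apply: eq_bigr => i _.
exact: linearZ.
Qed.

Section SkewWords.
Variables (k : fieldType) (V : vectType k) (gT : finGroupType).
Variable rho : linear_action V gT.

Definition tword (u : seq V) : tensor_alg V := \prod_(v <- u) tensor_inj v.

Lemma tword_pi (m : {fmonom V}) :
  quot_pi (@tensor_rel k V) (<< m >> : free_alg k V) = tword m.
Proof.
case: m => s; rewrite /tword; elim: s => [|v s IHs] /=.
  have -> : << FMonom [::] >> = 1 :> free_alg k V by rewrite -fmoneE.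
  by rewrite rmorph1 big_nil.
have -> : << FMonom (v :: s) >> = free_gen k v * << FMonom s >> :> free_alg k V.
  rewrite malgM_def fgmulUU mulr1; congr << _ >>.
  by apply/eqP; rewrite fmP fmM fmU.
by rewrite rmorphM /= big_cons IHs.
Qed.

Lemma free_alg_ind (P : free_alg k V -> Prop) :
  P 0 -> (forall a x y, P x -> P y -> P (a *: x + y)) ->
  (forall m : {fmonom V}, P << m >>) -> forall x, P x.
Proof.
move=> P0 PD Pm z; rewrite [z]monalgE; elim/big_rec: _ => // m x _ Px.
have -> : << z@_m *g m >> = z@_m *: (<< m >> : free_alg k V).
  by apply/malgP=> m'; rewrite mcoeffZ !mcoeffU mulrnAr mulr1.
exact: PD.
Qed.

Lemma tensor_alg_ind (P : tensor_alg V -> Prop) :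
  P 0 -> (forall a x y, P x -> P y -> P (a *: x + y)) ->
  (forall u, P (tword u)) -> forall x, P x.
Proof.
move=> P0 PD Pu x; rewrite -[x]quot_reprK.
elim/free_alg_ind: (quot_repr x) => [|a y z Py Pz|m].
- by rewrite raddf0.
- by rewrite linearP; apply: PD.
by rewrite tword_pi.
Qed.

Local Notation T := (tensor_skew_alg rho).

Definition sword (u : seq V) (g : gT) : T := skew_elem _ (tword u) g.

Lemma skew_elem_linear a (x y : tensor_alg V) g :
  skew_elem (tensor_action rho) (a *: x + y) g
  = a *: skew_elem _ x g + skew_elem _ y g.
Proof.
apply/ffunP => h; rewrite !ffunE; case: ifP => // _.
by rewrite scaler0 addr0.
Qed.

Lemma skew_elem0 g : skew_elem (tensor_action rho) 0 g = 0.
Proof. by apply/ffunP => h; rewrite !ffunE if_same. Qed.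

Lemma skew_alg_ind (P : T -> Prop) :
  P 0 -> (forall a x y, P x -> P y -> P (a *: x + y)) ->
  (forall u g, P (sword u g)) -> forall x, P x.
Proof.
move=> P0 PD Pu f.
have -> : f = \sum_g skew_elem _ (f g) g.
  apply/ffunP => h; rewrite sum_ffunE (bigD1 h) //= big1 => [|g gh].
    by rewrite ffunE eqxx addr0.
  by rewrite ffunE eq_sym (negPf gh).
elim/big_rec: _ => // g x _ Px.
suff Pg y : P (skew_elem _ y g) by rewrite -[X in X + _]scale1r; apply: PD.
elim/tensor_alg_ind: y => [|a y z Py Pz|u]; last exact: Pu.
  by rewrite skew_elem0.
by rewrite skew_elem_linear; apply: PD.
Qed.

Lemma swordM u g v h : sword u g * sword v h = sword (u ++ map (rho g) v) (g * h)%g.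
Proof.
rewrite /sword skew_elemM; congr (skew_elem _ _ _).
rewrite /tword big_cat /= big_map; congr (_ * _).
elim: v => [|x v IHv]; first by rewrite !big_nil rmorph1.
by rewrite !big_cons rmorphM /= tensor_act_inj IHv.
Qed.

Lemma sword_vect v : skew_vect rho v = sword [:: v] 1%g.
Proof. by rewrite /sword /tword big_seq1. Qed.

Lemma sword_group g : skew_group rho g = sword [::] g.
Proof. by rewrite /sword /tword big_nil. Qed.

End SkewWords.

(** * Linear maps on the tensor algebra from multilinear functions of words *)

Section MultilinearExtension.
Variables (k : fieldType) (V : vectType k) (W : lmodType k).
Variable phi : seq V -> W.
Hypothesis phi_linear : forall p q a u v,
  phi (p ++ (a *: u + v) :: q) = a *: phi (p ++ u :: q) + phi (p ++ v :: q).

Definition free_ext (z : free_alg k V) : W :=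
  \sum_(m <- msupp z) z@_m *: phi (m : {fmonom V}).

Lemma free_extw (d : {fset {fmonom V}}) z : (msupp z `<=` d)%fset ->
  free_ext z = \sum_(m <- d) z@_m *: phi m.
Proof.
move=> le; rewrite [LHS](big_fset_incl _ le) => //= x xd /mcoeff_outdom ->.
by rewrite scale0r.
Qed.

Lemma free_ext_linear : linear free_ext.
Proof.
move=> a x y; pose d := (msupp (a *: x + y)%R `|` (msupp x `|` msupp y))%fset.
have [dxy dx dy] : [/\ msupp (a *: x + y)%R `<=` d, msupp x `<=` d & msupp y `<=` d]%fset.
  by split; rewrite /d ?fsubsetUl // 1?fsetUCA ?fsubsetUl // fsetUA fsubsetUr.
rewrite (free_extw dxy) (free_extw dx) (free_extw dy).
rewrite scaler_sumr -big_split; apply: eq_bigr => m _ /=.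
by rewrite mcoeffD mcoeffZ scalerDl scalerA.
Qed.

HB.instance Definition _ := GRing.isLinear.Build k (free_alg k V) W _ free_ext
  free_ext_linear.

Lemma free_ext_linearB x y : free_ext (x - y) = free_ext x - free_ext y.
Proof. exact: raddfB. Qed.

Lemma free_ext_mon (m : {fmonom V}) : free_ext << m >> = phi m.
Proof.
by rewrite (free_extw msuppU_le) big_seq_fset1 mcoeffUU scale1r.
Qed.

(** By linearity both multipliers of a relator may be words; the relator then expresses linearity of
    [phi] in one letter. *)
Lemma free_ext_rel z : in_ideal (@tensor_rel k V) z -> free_ext z = 0.
Proof.
move=> Iz; suff E x y : free_ext (x * z * y) = 0.
  by rewrite -[z]mul1r -[1 * z]mulr1 E.
elim: Iz x y => {z} [z [a [u [v Ez]]]||z t _ IHz _ IHt|a z b _ IHz] x y.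
- move: x y; elim/free_alg_ind => [|b x1 x2 IH1 IH2|p] y.
  + by rewrite !mul0r raddf0.
  + have -> : (b *: x1 + x2) * z * y = b *: (x1 * z * y) + x2 * z * y.
      by rewrite !mulrDl -!scalerAl.
    apply: etrans (free_ext_linear b _ _) _.
    apply: etrans (congr2 (fun s t => b *: s + t) (IH1 y) (IH2 y)) _.
    by rewrite scaler0 addr0.
  elim/free_alg_ind: y => [|b y1 y2 IH1 IH2|q].
  + by rewrite mulr0 raddf0.
  + have -> : << p >> * z * (b *: y1 + y2) = b *: (<< p >> * z * y1) + << p >> * z * y2.
      by rewrite mulrDr free_scalerAr.
    apply: etrans (free_ext_linear b _ _) _.
    apply: etrans (congr2 (fun s t => b *: s + t) IH1 IH2) _.
    by rewrite scaler0 addr0.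
  have monM (w : V) : << p >> * free_gen k w * << q >>
      = << FMonom (p ++ w :: q) >> :> free_alg k V.
    rewrite !malgM_def !fgmulUU !mulr1; congr << _ >>.
    by apply/eqP; rewrite fmP !fmM fmU -catA.
  have -> : << p >> * z * << q >> = << p >> * free_gen k (a *: u + v) * << q >>
     - (a *: (<< p >> * free_gen k u * << q >>) + << p >> * free_gen k v * << q >>).
    by rewrite Ez mulrBr mulrBl mulrDr mulrDl -free_scalerAr -scalerAl.
  apply: etrans (free_ext_linearB _ _) _.
  apply: etrans (congr2 (fun s t => s - t) (congr1 _ (monM _))
    (etrans (free_ext_linear a _ _) (congr2 (fun s t => a *: s + t)
       (congr1 _ (monM _)) (congr1 _ (monM _))))) _.
  by rewrite !free_ext_mon /= phi_linear subrr.
- by rewrite mulr0 mul0r raddf0.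
- have -> : x * (z + t) * y = x * z * y + x * t * y by rewrite mulrDr mulrDl.
  apply: etrans (raddfD _ _ _) _.
  exact: etrans (congr2 +%R (IHz x y) (IHt x y)) (addr0 0).
have E : x * (a * z * b) * y = (x * a) * z * (b * y).
  exact: mulr_regroup.
exact: etrans (congr1 free_ext E) (IHz (x * a) (b * y)).
Qed.

Definition tensor_ext (x : tensor_alg V) : W := free_ext (quot_repr x).

Lemma tensor_ext_pi z : tensor_ext (quot_pi _ z) = free_ext z.
Proof.
apply/eqP; rewrite -subr_eq0 -linearB; apply/eqP/free_ext_rel.
exact: quot_repr_pi.
Qed.

Lemma tensor_ext_linear : linear tensor_ext.
Proof.
move=> a x y; rewrite -[x]quot_reprK -[y]quot_reprK -linearP.
by rewrite !tensor_ext_pi linearP.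
Qed.

HB.instance Definition _ := GRing.isLinear.Build k (tensor_alg V) W _ tensor_ext
  tensor_ext_linear.

Lemma tensor_ext_word u : tensor_ext (tword u) = phi u.
Proof. by rewrite -(tword_pi (FMonom u)) tensor_ext_pi free_ext_mon. Qed.

End MultilinearExtension.

End TensorWords.
Import TensorWords.

From mathcomp Require Import ssrcomplements mpoly.

(** * Linear forms are prime *)

Section PrimeElements.
Variable A : idomainType.
Implicit Types (p q r : A) (s : seq A).

Definition divides p q := exists r, q = r * p.

Definition prime_elt p :=
  [/\ p != 0, ~ divides p 1
    & forall q r, divides p (q * r) -> divides p q \/ divides p r].

Lemma prime_elt_prod p s : prime_elt p -> divides p (\prod_(q <- s) q) ->
  exists2 q, q \in s & divides p q.
Proof.
case=> _ p1 p_prime; elim: s => [|q s IHs]; rewrite ?big_nil // big_cons.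
case/p_prime => [?|/IHs[r rs pr]]; first by exists q; rewrite ?mem_head.
by exists r; rewrite // inE rs orbT.
Qed.

Lemma coprime_prod_divides s t p :
  {in s, forall q, prime_elt q} -> {in s & t, forall q r, ~ divides q r} ->
  divides (\prod_(q <- s) q) (p * \prod_(q <- t) q) ->
  divides (\prod_(q <- s) q) p.
Proof.
elim: s p => [|q s IHs] p s_prime s_t.
  by exists p; rewrite big_nil mulr1.
have q_prime := s_prime q (mem_head _ _); have [q0 _ qM] := q_prime.
rewrite big_cons => -[r Er].
have : divides q (p * \prod_(q <- t) q).
  by exists (r * \prod_(q <- s) q); rewrite Er; ring.
case/qM => [[p' Ep]|/(prime_elt_prod q_prime)[q' q't]]; last first.
  by move/s_t => []; rewrite ?mem_head.
have [|||r' Ep'] := IHs p'.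
- by move=> q' q's; apply: s_prime; rewrite inE q's orbT.
- by move=> q' r' q's; apply: s_t; rewrite inE q's orbT.
- exists r; apply: (mulfI q0); move: Er; rewrite Ep => Er.
  by rewrite mulrA [q * p']mulrC Er; ring.
by exists r'; rewrite Ep Ep'; ring.
Qed.

End PrimeElements.

Section LinearForms.
Variables (k : fieldType) (n : nat).
Implicit Types (a b : 'I_n -> k) (p q : {mpoly k[n]}).

Definition lform a : {mpoly k[n]} := \sum_i a i *: 'X_i.

Lemma mcoeff_lform a i : (lform a)@_U_(i) = a i.
Proof.
rewrite raddf_sum (bigD1 i) //= big1 => [|j ji].
  by rewrite mcoeffZ mcoeffX eqxx mulr1 addr0.
rewrite mcoeffZ mcoeffX; case: eqP => [/mnmP/(_ i)|]; last by rewrite mulr0.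
by rewrite !mnm1E eqxx (negPf ji).
Qed.

Section Elimination.
Variables (a : 'I_n -> k) (j : 'I_n).
Hypothesis aj0 : a j != 0.

(* Substitution solving [lform a = 0] for the variable of index [j].           *)
Definition eliminate : n.-tuple {mpoly k[n]} :=
  [tuple 'X_i - ((i == j)%:R / a j) *: lform a | i < n].

Lemma eliminate_lform b :
  lform b \mPo eliminate = lform (fun i => b i - b j / a j * a i).
Proof.
rewrite /lform raddf_sum /=.
transitivity (lform b - (b j / a j) *: lform a); last first.
  rewrite /lform scaler_sumr -sumrB; apply: eq_bigr => i _.
  by rewrite scalerBl scalerA.
rewrite (eq_bigr (fun i => b i *: 'X_i - (b i * ((i == j)%:R / a j)) *: lform a)).
  rewrite sumrB -scaler_suml; congr (_ - _ *: _).
  rewrite (bigD1 j) //= big1 => [|i /negPf ->]; last by rewrite mul0r mulr0.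
  by rewrite eqxx mul1r addr0.
move=> i _; rewrite comp_mpolyZ comp_mpolyXU -tnth_nth tnth_mktuple.
by rewrite scalerBr scalerA.
Qed.

Lemma eliminate_self : lform a \mPo eliminate = 0.
Proof.
rewrite eliminate_lform /lform big1 // => i _.
by rewrite divff // mul1r subrr scale0r.
Qed.

Lemma eliminateP p : divides (lform a) (p - (p \mPo eliminate)).
Proof.
elim/mpolyind: p => [|c m p _ _ [r Er]].
  by exists 0; rewrite raddf0 subrr mul0r.
suff [r' Er'] : divides (lform a) ('X_[m] - ('X_[m] \mPo eliminate)).
  exists (c *: r' + r); rewrite comp_mpolyD comp_mpolyZ opprD addrACA Er.
  by rewrite -scalerBr Er' mulrDl scalerAl.
rewrite mpolyXE_id; elim/big_rec: _ => [|i q _ [q' Eq']].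
  by exists 0; rewrite rmorph1 subrr mul0r.
have [r' Er'] : divides (lform a) ('X_i ^+ m i - ('X_i ^+ m i \mPo eliminate)).
  elim: (m i) => [|e [r' Er']].
    by exists 0; rewrite expr0 comp_mpoly1 subrr mul0r.
  exists ('X_i * r' + ((i == j)%:R / a j) *: ('X_i ^+ e \mPo eliminate)).
  rewrite exprS rmorphM /= comp_mpolyXU -tnth_nth tnth_mktuple.
  move: Er'; set x1 := _ \mPo _ => /(canRL (subrK _)) ->.
  by rewrite -!mul_mpolyC; ring.
exists (r' * q + ('X_i ^+ m i \mPo eliminate) * q').
rewrite rmorphM /=; move: Eq' Er'.
set q1 := q \mPo _; set x1 := _ \mPo _ => /(canRL (subrK _)) ->.
by move=> /(canRL (subrK _)) ->; ring.
Qed.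

(** The multiples of [lform a] are thus the kernel of a ring endomorphism of a domain, which makes
    [lform a] prime. *)
Lemma divides_lformE p : divides (lform a) p <-> p \mPo eliminate = 0.
Proof.
split=> [[r ->]|p0]; first by rewrite rmorphM /= eliminate_self mulr0.
by have := eliminateP p; rewrite p0 subr0.
Qed.

Lemma prime_lform : prime_elt (lform a).
Proof.
split=> [|/divides_lformE/eqP|p q].
- apply: contraNneq aj0 => a0.
  by rewrite -mcoeff_lform a0 mcoeff0.
- by rewrite comp_mpoly1 oner_eq0.
rewrite !divides_lformE rmorphM /= => /eqP.
by rewrite mulf_eq0 => /orP[]/eqP; [left|right].
Qed.

Lemma divides_lform b : divides (lform a) (lform b) -> forall i, b i = b j / a j * a i.
Proof.
rewrite divides_lformE eliminate_lform => b0 i; apply/eqP; rewrite -subr_eq0.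
by rewrite -(mcoeff_lform (fun i => b i - b j / a j * a i)) b0 mcoeff0.
Qed.

End Elimination.
End LinearForms.

(** * Normal forms of words *)

Section PolynomialDegree.
Variables (R : nzRingType) (n : nat).
Implicit Types p q : {mpoly R[n]}.

(** [msize] is the degree plus one, and 0 at 0, so [msize p <= d] says that [p] has degree less than
    [d]. All degree bounds below have this form. *)
Lemma msizeD_leq d p q :
  (msize p <= d -> msize q <= d -> msize (p + q) <= d)%N.
Proof.
by move=> pd qd; apply: leq_trans (msizeD_le p q) _; rewrite geq_max pd.
Qed.

Lemma msizeB_leq d p q :
  (msize p <= d -> msize q <= d -> msize (p - q) <= d)%N.
Proof. by move=> pd qd; apply: msizeD_leq; rewrite ?msizeN. Qed.

Lemma msize_sum_leq d (I : Type) (r : seq I) (P : pred I) F :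
  (forall i, P i -> (msize (F i : {mpoly R[n]}) <= d)%N) ->
  (msize (\sum_(i <- r | P i) F i) <= d)%N.
Proof.
move=> Fd; elim/big_rec: _ => [|i p Pi pd]; first by rewrite msize0.
by apply: msizeD_leq => //; apply: Fd.
Qed.

Lemma dhomog_msize_leq d p : p \is d.-homog -> (msize p <= d.+1)%N.
Proof.
move/dhomogP => p_d; rewrite msizeE big_tnth.
by apply/bigmax_leqP => i _; rewrite p_d // mem_tnth.
Qed.

End PolynomialDegree.

Definition le_ord (n : nat) : rel 'I_n := relpre val leq.

Lemma le_ord_total n : total (@le_ord n).
Proof. by move=> i j; apply: leq_total. Qed.

Lemma le_ord_trans n : transitive (@le_ord n).
Proof. by move=> j i l; apply: leq_trans. Qed.

Lemma le_ord_anti n : antisymmetric (@le_ord n).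
Proof. by move=> i j ij; apply/val_inj/anti_leq. Qed.

(** * Multilinear extension of functions on words in a basis of [V] *)

Section Words.
Variables (k : fieldType) (V : vectType k).
Local Notation N := (\dim {:V}).
Local Notation S := {mpoly k[N]}.

Definition vb (i : 'I_N) : V := (vbasis {:V})`_i.

Definition vlin (v : V) : S := lform (fun i => coord (vbasis {:V}) i v).

Lemma vb_sum v : v = \sum_i coord (vbasis {:V}) i v *: vb i.
Proof. by rewrite {1}[v](coord_vbasis (memvf v)). Qed.

Lemma vlin_linear : linear vlin.
Proof.
move=> a u v; rewrite /vlin /lform scaler_sumr -big_split /=.
by apply: eq_bigr => i _; rewrite linearP scalerDl scalerA.
Qed.

HB.instance Definition _ := GRing.isLinear.Build k V S _ vlin vlin_linear.

Lemma vlin_vb i : vlin (vb i) = 'X_i.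
Proof.
rewrite /vlin /lform (bigD1 i) //= big1 => [|j ji].
  by rewrite coord_free ?(basis_free (vbasisP _)) // eqxx scale1r addr0.
rewrite coord_free ?(basis_free (vbasisP _)) //.
by rewrite eq_sym (negPf ji) scale0r.
Qed.

Definition word_mon (w : seq 'I_N) : S := \prod_(i <- w) 'X_i.
Definition vword_mon (u : seq V) : S := \prod_(v <- u) vlin v.

Lemma vlin_homog v : vlin v \is 1.-homog.
Proof.
by apply: rpred_sum => i _; apply: rpredZ; rewrite dhomogX; apply/eqP/mdeg1.
Qed.

Lemma vword_mon_homog u : vword_mon u \is (size u).-homog.
Proof.
elim: u => [|v u IHu]; rewrite /vword_mon ?big_nil ?dhomog1 // big_cons.
exact: dhomogM (vlin_homog v) IHu.
Qed.

Fixpoint mlin_ext (f : seq 'I_N -> S) (u : seq V) : S :=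
  if u is v :: u' then
    \sum_i coord (vbasis {:V}) i v *: mlin_ext (fun w => f (i :: w)) u'
  else f [::].

Lemma eq_mlin f g u : (forall w, size w = size u -> f w = g w) ->
  mlin_ext f u = mlin_ext g u.
Proof.
elim: u f g => [|v u IHu] f g fg /=; first exact: fg.
apply: eq_bigr => i _; congr (_ *: _); apply: IHu => w sz.
by apply: fg; rewrite /= sz.
Qed.

Lemma mlin_ext_linear f p q a u v :
  mlin_ext f (p ++ (a *: u + v) :: q)
  = a *: mlin_ext f (p ++ u :: q) + mlin_ext f (p ++ v :: q).
Proof.
elim: p f => [|x p IHp] f /=.
  rewrite scaler_sumr -big_split /=; apply: eq_bigr => i _.
  by rewrite linearP scalerDl scalerA.
rewrite scaler_sumr -big_split /=; apply: eq_bigr => i _.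
by rewrite IHp scalerDr !scalerA mulrC.
Qed.

Lemma mlin_ext_add f p q u v :
  mlin_ext f (p ++ (u + v) :: q) = mlin_ext f (p ++ u :: q) + mlin_ext f (p ++ v :: q).
Proof. by rewrite -[u]scale1r mlin_ext_linear !scale1r. Qed.

Lemma mlin_ext_scalar f p q u a :
  mlin_ext f (p ++ (a *: u) :: q) = a *: mlin_ext f (p ++ u :: q).
Proof.
have f0 : mlin_ext f (p ++ 0 :: q) = 0.
  have := mlin_ext_linear f p q 1 0 0; rewrite scaler0 addr0 scale1r.
  by move/eqP; rewrite -subr_eq0 opprD addNKr oppr_eq0 => /eqP.
by have := mlin_ext_linear f p q a u 0; rewrite addr0 f0 addr0.
Qed.

Lemma mlin_ext0 f p q : mlin_ext f (p ++ 0 :: q) = 0.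
Proof. by rewrite -(scale0r (0 : V)) mlin_ext_scalar scale0r. Qed.

Lemma mlin_extB f p q u v :
  mlin_ext f (p ++ (u - v) :: q) = mlin_ext f (p ++ u :: q) - mlin_ext f (p ++ v :: q).
Proof. by rewrite addrC -scaleN1r mlin_ext_linear scaleN1r addrC. Qed.

Lemma mlin_ext_vb f w : mlin_ext f [seq vb i | i <- w] = f w.
Proof.
elim: w f => //= i w IHw f; rewrite (bigD1 i) //= big1 => [|j ji].
  by rewrite coord_free ?(basis_free (vbasisP _)) // eqxx scale1r addr0 IHw.
rewrite coord_free ?(basis_free (vbasisP _)) //.
by rewrite eq_sym (negPf ji) scale0r.
Qed.

Lemma mlin_extD f g u : mlin_ext (fun w => f w + g w) u = mlin_ext f u + mlin_ext g u.
Proof.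
elim: u f g => //= v u IHu f g; rewrite -big_split /=.
by apply: eq_bigr => i _; rewrite IHu scalerDr.
Qed.

Lemma mlin_ext_word_mon u : mlin_ext word_mon u = vword_mon u.
Proof.
suff mM p : mlin_ext (fun w => p * word_mon w) u = p * vword_mon u.
  rewrite -[RHS]mul1r -mM; apply: eq_mlin => w _; by rewrite mul1r.
elim: u p => [|v u IHu] p /=; first by rewrite /word_mon /vword_mon !big_nil.
rewrite /vword_mon big_cons -/(vword_mon u) mulrCA mulr_suml.
apply: eq_bigr => i _; rewrite -scalerAl mulrA ['X_i * p]mulrC -IHu; congr (_ *: _).
by apply: eq_mlin => w _; rewrite /word_mon big_cons mulrA.
Qed.

Lemma mlin_ext_closed (P : S -> Prop) f u :
  P 0 -> (forall a x y, P x -> P y -> P (a *: x + y)) ->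
  (forall w, size w = size u -> P (f w)) -> P (mlin_ext f u).
Proof.
move=> P0 PD; elim: u f => [|v u IHu] f Pf /=; first exact: Pf.
elim/big_rec: _ => // i x _ Px; apply: PD => //.
by apply: IHu => w sz; apply: Pf; rewrite /= sz.
Qed.

Lemma vword_ind n (Q : seq V -> Prop) :
  (forall p q, Q (p ++ 0 :: q)) ->
  (forall a u v p q, Q (p ++ u :: q) -> Q (p ++ v :: q) ->
    Q (p ++ (a *: u + v) :: q)) ->
  (forall w, size w = n -> Q [seq vb i | i <- w]) ->
  forall u, size u = n -> Q u.
Proof.
move=> Q0 QD Qw u sz.
suff Qwu w : (size w + size u)%N = n -> Q ([seq vb i | i <- w] ++ u).
  exact: (Qwu [::]).
elim: u w {sz} => [|v u IHu] w sz; first by rewrite cats0; apply: Qw; rewrite -sz addn0.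
rewrite [v]vb_sum; elim/big_rec: _ => [|i x _ Qx]; first exact: Q0.
apply: QD => //; rewrite -cat_rcons -map_rcons; apply: IHu.
by rewrite size_rcons addSnnS.
Qed.

End Words.
Arguments vb {k V}.
Arguments word_mon {k V}.
Arguments vword_mon {k V}.
Arguments mlin_ext {k V}.

(** * The normal form and its exchange rule *)

Section NormalForm.
Variables (k : fieldType) (V : vectType k) (gT : finGroupType).
Variables (rho : linear_action V gT) (kap : gT -> V -> V -> k).
Local Notation N := (\dim {:V}).
Local Notation S := {mpoly k[N]}.

Hypothesis kap_linear : forall g a u v y,
  kap g (a *: u + v) y = a * kap g u y + kap g v y.
Hypothesis kap_anti : forall g x y, kap g x y = - kap g y x.
Hypothesis kap_diag : forall g x, kap g x x = 0.
Hypothesis kap_conj : forall g h x y,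
  kap (h * g * h^-1)%g (rho h x) (rho h y) = kap g x y.
Hypothesis kap_jacobi : forall g x y z,
  kap g x y *: (rho g z - z) + kap g y z *: (rho g x - x)
  + kap g z x *: (rho g y - y) = 0.

Lemma kap_linear_r g a u v x :
  kap g x (a *: u + v) = a * kap g x u + kap g x v.
Proof. by rewrite kap_anti kap_linear !(kap_anti g _ x); ring. Qed.

(** The component at [h] of the product of a, the commutator of x and y, and b: moving [g] to the
    right past [b] applies [rho g] to it, and right multiplication by [g] takes the component at
    [h g^-1] to [h]. *)
Definition contract (f : gT -> seq 'I_N -> S) (h : gT) (a : seq 'I_N)
    (x y : 'I_N) (b : seq 'I_N) : S :=
  \sum_g kap g (vb x) (vb y) *:
    mlin_ext (f (h * g^-1)%g) (map vb a ++ map (rho g) (map vb b)).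

(* The value of [nf n] at [h] and a word w of length n is the component at h   *)
(* of the normal form of the product of w.                                     *)
Fixpoint nf (n : nat) (h : gT) (w : seq 'I_N) : S :=
  word_mon w *+ (h == 1%g) +
  if n is n'.+2 then isort_cost (@le_ord _) (contract (nf n') h) [::] w else 0.

Definition nf_swap n := forall h a x y b, (size a + size b).+2 = n ->
  mlin_ext (nf n h) (a ++ x :: y :: b) - mlin_ext (nf n h) (a ++ y :: x :: b)
  = \sum_g kap g x y *:
      mlin_ext (nf n.-2 (h * g^-1)%g) (a ++ map (rho g) b).

Section Step.
Variable n : nat.
Hypothesis IHn : nf_swap n.
Variable h : gT.
Local Notation d := (contract (nf n) h).

Lemma contract_anti a x y b : d a x y b = - d a y x b.
Proof.
rewrite -sumrN; apply: eq_bigr => g _.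
by rewrite kap_anti scaleNr.
Qed.

Lemma contract_diag a x b : d a x x b = 0.
Proof. by rewrite [d _ _ _ _]big1 // => g _; rewrite kap_diag scale0r. Qed.

(** Disjoint exchanges may be made in either order. Once the left pair has contributed [g], the
    right pair is [rho g z], [rho g t]; conjugating its group element by [g] and using [kap_conj]
    turns both sides into the same double sum. *)
Lemma contract_far a x y b z t c :
  (size a + size b + size c).+4 = n.+2 ->
  d a x y (b ++ z :: t :: c) - d a x y (b ++ t :: z :: c) =
  d (a ++ x :: y :: b) z t c - d (a ++ y :: x :: b) z t c.
Proof.
move=> sz; rewrite /d -!sumrB.
transitivity (\sum_g \sum_r (kap g (vb x) (vb y) * kap r (vb z) (vb t)) *:
  mlin_ext (nf n.-2 (h * r^-1 * g^-1)%g)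
    (map vb a ++ map (rho g) (map vb b ++ map (rho r) (map vb c)))).
  apply: eq_bigr => g _; rewrite -scalerBr !map_cat /= !catA IHn; last first.
    by rewrite size_cat !size_map; lia.
  rewrite scaler_sumr (reindex_inj (conjg_inj g^-1%g)) /=.
  apply: eq_bigr => r _; rewrite scalerA conjgE invgK mulgA.
  rewrite kap_conj; congr (_ *: mlin_ext (nf _ _) _).
    by rewrite !invMg invgK !mulgA mulgKV.
  rewrite [in RHS]map_cat catA -!map_comp; congr (_ ++ _); apply: eq_map => i.
  by rewrite /= -!comp_lfunE -!lin_actM -mulgA mulVg mulg1.
rewrite exchange_big; apply: eq_bigr => r _.
rewrite -scalerBr !map_cat /= -!catA /= IHn; last first.
  by rewrite size_cat !size_map; lia.
rewrite scaler_sumr; apply: eq_bigr => g _.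
by rewrite scalerA mulrC.
Qed.

(** For each [g] the two sides differ by the Jacobi expression, inserted as one letter between [a]
    and [rho g c]. *)
Lemma contract_braid a x y z c : (size a + size c).+3 = n.+2 ->
  d a x y (z :: c) + d (rcons a y) x z c + d a y z (x :: c) =
  d (rcons a x) y z c + d a x z (y :: c) + d (rcons a z) x y c.
Proof.
move=> sz; rewrite /d -!big_split; apply: eq_bigr => g _ /=.
rewrite !map_rcons !cat_rcons; set m := mlin_ext _; set p := map vb a.
set q := map _ _; apply/eqP; rewrite -subr_eq0; apply/eqP.
transitivity (kap g (vb x) (vb y) *: m (p ++ (rho g (vb z) - vb z) :: q)
  + kap g (vb y) (vb z) *: m (p ++ (rho g (vb x) - vb x) :: q)
  + kap g (vb z) (vb x) *: m (p ++ (rho g (vb y) - vb y) :: q)).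
  rewrite /m !mlin_extB (kap_anti g (vb z)) scaleNr !scalerBr.
  by rewrite -!mul_mpolyC; ring.
by rewrite /m -!mlin_ext_scalar -!mlin_ext_add kap_jacobi mlin_ext0.
Qed.

Lemma nf_swap_step a x y b : (size a + size b).+2 = n.+2 ->
  nf n.+2 h (a ++ x :: y :: b) - nf n.+2 h (a ++ y :: x :: b) = d a x y b.
Proof.
move=> sz /=.
have -> : word_mon (a ++ x :: y :: b) = word_mon (a ++ y :: x :: b) :> S.
  by rewrite /word_mon !big_cat !big_cons /=; ring.
rewrite opprD addrACA subrr add0r.
exact: (isort_cost_swap (@le_ord_total _) (@le_ord_trans _) (@le_ord_anti _)
  (fun a x y b _ => contract_anti a x y b) contract_diag contract_far
  contract_braid).
Qed.

End Step.

(** The rule for length [n] gives the closedness conditions for length [n.+2], so insertion sort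
    yields the rule at basis vectors; multilinearity in [a], [x], [y], [b] does the rest. *)
Lemma nf_swapP n : nf_swap n.
Proof.
elim/ltn_ind: n => -[|[|n]] IHn h a x y b sz; try by move: sz; lia.
have {}IHn := IHn n (leqnSn _); rewrite /=.
pose Q a x y b := mlin_ext (nf n.+2 h) (a ++ x :: y :: b)
  - mlin_ext (nf n.+2 h) (a ++ y :: x :: b)
  = \sum_g kap g x y *: mlin_ext (nf n (h * g^-1)%g) (a ++ map (rho g) b).
have Qa x' y' b' : (forall w, size w = size a -> Q (map vb w) x' y' b') ->
    Q a x' y' b'.
  move=> Qw; apply: (@vword_ind _ _ (size a) (fun a => Q a x' y' b')) => //.
    move=> p q; rewrite /Q -!catA !mlin_ext0 subrr big1 // => g _.
    by rewrite -catA mlin_ext0 scaler0.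
  move=> c u v p q; rewrite /Q -!catA /= !mlin_ext_linear => Qu Qv.
  rewrite opprD addrACA -scalerBr Qu Qv scaler_sumr -big_split /=.
  apply: eq_bigr => g _.
  by rewrite -!catA mlin_ext_linear scalerDr !scalerA mulrC.
have Qb a' x' y' : (forall w, size w = size b -> Q a' x' y' (map vb w)) ->
    Q a' x' y' b.
  move=> Qw; apply: (@vword_ind _ _ (size b) (fun b => Q a' x' y' b)) => //.
    move=> p q; rewrite /Q -!cat_cons !catA !mlin_ext0 subrr big1 // => g _.
    by rewrite map_cat /= linear0 catA mlin_ext0 scaler0.
  move=> c u v p q; rewrite /Q -!cat_cons !catA !mlin_ext_linear => Qu Qv.
  rewrite opprD addrACA -scalerBr Qu Qv scaler_sumr -big_split /=.
  apply: eq_bigr => g _; rewrite !map_cat /= linearP !catA.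
  by rewrite mlin_ext_linear scalerDr !scalerA mulrC.
have Qx a' y' b' : (forall i, Q a' (vb i) y' b') -> Q a' x y' b'.
  move=> Qi; rewrite [x]vb_sum; elim/big_rec: _ => [|i v _ Qv].
    rewrite /Q -cat_rcons -(cat_rcons _ a') !cat_rcons mlin_ext0.
    rewrite -[a' ++ [:: y', 0 & b']]cat_rcons mlin_ext0 subrr big1 // => g _.
    have := kap_linear g 1 0 0 y'; rewrite scaler0 addr0 mul1r.
    by move/eqP; rewrite -subr_eq0 opprD addNKr oppr_eq0 => /eqP ->; rewrite scale0r.
  rewrite /Q mlin_ext_linear -(cat_rcons _ a') mlin_ext_linear !cat_rcons.
  rewrite opprD addrACA -scalerBr (Qi i) Qv scaler_sumr -big_split /=.
  apply: eq_bigr => g _; rewrite kap_linear scalerDl !scalerA.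
  by [].
have Qy a' x' b' : (forall j, Q a' x' (vb j) b') -> Q a' x' y b'.
  move=> Qj; rewrite [y]vb_sum; elim/big_rec: _ => [|i v _ Qv].
    rewrite /Q -cat_rcons mlin_ext0 mlin_ext0 subrr big1 // => g _.
    have := kap_linear_r g 1 0 0 x'; rewrite scaler0 addr0 mul1r.
    by move/eqP; rewrite -subr_eq0 opprD addNKr oppr_eq0 => /eqP ->; rewrite scale0r.
  rewrite /Q mlin_ext_linear -(cat_rcons _ a') mlin_ext_linear !cat_rcons.
  rewrite opprD addrACA -scalerBr (Qj i) Qv scaler_sumr -big_split /=.
  apply: eq_bigr => g _; rewrite kap_linear_r scalerDl !scalerA.
  by [].
apply: Qa => wa sza; apply: Qb => wb szb; apply: Qx => i; apply: Qy => j.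
rewrite /Q -!map_cons -!map_cat !mlin_ext_vb nf_swap_step //; last by lia.
Qed.

(** A correction trades two letters for a group element, so its degree is below that of the word. *)
Lemma nf_lead n h u : size u = n ->
  (msize (mlin_ext (nf n h) u - vword_mon u *+ (h == 1%g)) <= n)%N.
Proof.
elim/ltn_ind: n h u => n IHn h u sz.
have -> : mlin_ext (nf n h) u = vword_mon u *+ (h == 1%g) + mlin_ext (fun w =>
   if n is n'.+2 then isort_cost (@le_ord _) (contract (nf n') h) [::] w else 0) u.
  rewrite -mlin_ext_word_mon -[RHS]addr0.
  transitivity (mlin_ext (fun w => word_mon w *+ (h == 1%g) + (if n is n'.+2
      then isort_cost (@le_ord _) (contract (nf n') h) [::] w else 0)) u).
    by apply: eq_mlin => w _; case: (n) => [|[]].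
  rewrite mlin_extD addr0; congr (_ + _); case: (h == 1%g) => //.
  rewrite mulr0n.
  apply: (@mlin_ext_closed _ _ (fun s => s = 0)) => [|a x y /= -> ->|w _] //=.
  by rewrite scaler0 addr0.
rewrite addrC addKr.
apply: (@mlin_ext_closed _ _ (fun s => msize s <= n)%N); first by rewrite msize0.
  move=> a x y xn yn; apply: msizeD_leq => //.
  exact: leq_trans (msizeZ_le _ _) xn.
case: n IHn sz => [|[|n]] IHn sz w szw; try by rewrite msize0.
apply: (@isort_cost_closed _ _ _ _ n.+2 (fun s => msize s <= n.+2)%N).
- by rewrite msize0.
- exact: msizeD_leq.
- move=> a x y b szab; apply: msize_sum_leq => g _.
  apply: leq_trans (msizeZ_le _ _) _.
  set v := _ ++ _; have szv : size v = n by rewrite size_cat !size_map; case: szab.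
  rewrite -[mlin_ext _ _](subrK (vword_mon v *+ (h * g^-1 == 1)%g)).
  apply: msizeD_leq; first exact: leq_trans (IHn n (leqnSn _) _ _ szv) (leqW (leqnSn _)).
  case: eqP => _; last by rewrite mulr0n msize0.
  by apply: leq_trans (dhomog_msize_leq (vword_mon_homog v)) _; rewrite szv.
by rewrite szw.
Qed.

Lemma nf_sorted n h w : size w = n -> sorted (@le_ord _) w ->
  nf n h w = word_mon w *+ (h == 1%g).
Proof.
case: n => [|[|n]] sz w_sorted /=; rewrite ?addr0 //.
by rewrite isort_cost_sorted ?addr0.
Qed.

End NormalForm.

(** * The symplectic action *)

Section SymplecticAction.
Variables (k : fieldType) (V : vectType k) (gT : finGroupType).
Variables (rho : linear_action V gT) (omega : {skew_symmetric V}).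
Variable c : gT -> k.
Hypothesis gT_neq0 : #|gT|%:R != 0 :> k.
Hypothesis k_neq2 : 2%:R != 0 :> k.
Hypothesis omega_nondeg : nondegenerate omega.
Hypothesis rho_inj : injective rho.
Hypothesis omega_rho : forall g x y, omega (rho g x) (rho g y) = omega x y.
Hypothesis c_conj :
  forall s g, s \in sympl_refl rho -> c (s ^ g)%g = c s.

Local Notation im s := (limg (\1 - rho s)%VF).
Local Notation ker s := (lker (\1 - rho s)%VF).

Lemma omega_anti x y : omega x y = - omega y x.
Proof. by rewrite hermC expr1 mulN1r. Qed.

Lemma omega_diag x : omega x x = 0.
Proof.
have /eqP := omega_anti x x; rewrite -addr_eq0 -mulr2n -mulr_natl.
by rewrite mulf_eq0 (negPf k_neq2) => /eqP.
Qed.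

Lemma act_invK g x : rho g (rho g^-1%g x) = x.
Proof. by rewrite -comp_lfunE -lin_actM mulgV lin_act1 id_lfunE. Qed.

Lemma act_inj g : injective (rho g).
Proof.
apply: (can_inj (g := rho g^-1%g)) => x.
by have := act_invK g^-1%g x; rewrite invgK.
Qed.

Lemma fix_kerE s x : (x \in ker s) = (rho s x == x).
Proof.
by rewrite memv_ker add_lfunE opp_lfunE id_lfunE subr_eq0 eq_sym.
Qed.

Lemma memv_im s x : x - rho s x \in im s.
Proof.
by rewrite -[x in x - _]id_lfunE -opp_lfunE -add_lfunE memv_img ?memvf.
Qed.

Lemma memv_imP s x : x \in im s -> exists y, x = y - rho s y.
Proof.
by case/memv_imgP => y _ ->; exists y; rewrite add_lfunE opp_lfunE id_lfunE.
Qed.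

Lemma im_conj s h : im (h * s * h^-1)%g = (rho h @: im s)%VS.
Proof.
apply/eqP; rewrite eqEsubv; apply/andP; split; apply/subvP => x.
  case/memv_imP => y ->; rewrite -[y in y - _](act_invK h) !lin_actM.
  by rewrite !comp_lfunE -linearB memv_img // memv_im.
case/memv_imgP => z /memv_imP[y ->] ->; rewrite linearB /=.
have -> : rho h (rho s y) = rho (h * s * h^-1)%g (rho h y).
  by rewrite -!comp_lfunE -!lin_actM mulgKV.
exact: memv_im.
Qed.

Lemma ker_conj s h x : (rho h x \in ker (h * s * h^-1)%g) = (x \in ker s).
Proof.
rewrite !fix_kerE -comp_lfunE -lin_actM mulgKV lin_actM comp_lfunE.
by rewrite (inj_eq (@act_inj h)).
Qed.

Lemma refl_conj s h : ((h * s * h^-1)%g \in sympl_refl rho) = (s \in sympl_refl rho).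
Proof.
rewrite !inE im_conj limg_dim_eq //.
apply/eqP; rewrite -subv0; apply/subvP => x /memv_capP[_].
rewrite memv_ker => /eqP hx0; rewrite memv0 -(act_invK h^-1%g x) invgK hx0.
by rewrite linear0.
Qed.

Local Notation pr s := (daddv_pi (im s) (ker s)).

Lemma im_ker_split s x :
  x = pr s x + daddv_pi (ker s) (im s) x.
Proof. by rewrite daddv_pi_add ?cap_im_ker // add_im_ker // memvf. Qed.

Lemma pr_unique s u v : u \in im s -> v \in ker s -> pr s (u + v) = u.
Proof.
move=> u_im v_ker; have uv := im_ker_split s (u + v).
have d0 : u - pr s (u + v) \in (im s :&: ker s)%VS.
  rewrite memv_cap rpredB ?memv_pi //=.
  have -> : u - pr s (u + v) = daddv_pi (ker s) (im s) (u + v) - v.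
    apply/eqP; rewrite subr_eq addrAC eq_sym subr_eq addrC -uv.
    by [].
  by rewrite rpredB ?memv_pi.
apply/eqP; rewrite -subr_eq0 -opprB oppr_eq0 -memv0.
by rewrite cap_im_ker in d0.
Qed.

Lemma pr_conj s h x : pr (h * s * h^-1)%g (rho h x) = rho h (pr s x).
Proof.
rewrite {1}(im_ker_split s x) linearD pr_unique //.
  by rewrite im_conj memv_img // memv_pi.
by rewrite ker_conj memv_pi.
Qed.

Lemma im_ker_orth s x y : x \in im s -> y \in ker s -> omega x y = 0.
Proof.
case/memv_imP => z ->; rewrite fix_kerE => /eqP sy.
by rewrite linearBl /= -{2}sy omega_rho subrr.
Qed.

Lemma omega_im_nondeg s x : x \in im s -> x != 0 ->
  exists2 y, y \in im s & omega x y != 0.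
Proof.
move=> x_im x0; have : x \notin orthov omega fullv.
  by rewrite (eqP omega_nondeg) memv0.
case/mem_orthovPn => y _; rewrite (im_ker_split s y) linearDr /=.
have y_ker := memv_pi (ker s) (im s) y; rewrite (im_ker_orth x_im y_ker) addr0 => xy.
by exists (pr s y); rewrite ?memv_pi.
Qed.

Lemma im_neq0 s : s != 1%g -> exists2 x, x \in im s & x != 0.
Proof.
move=> s1; exists (vpick (im s)); first exact: memv_pick.
rewrite vpick0.
apply: contraNneq s1 => im0; apply/eqP/rho_inj; apply/lfunP => x.
have := memv_im s x; rewrite im0 memv0 subr_eq0 => /eqP <-.
by rewrite lin_act1 id_lfunE.
Qed.

(** [omega] is nondegenerate on the image of 1 - s, as this is orthogonal to the complementary
    kernel; being alternating, it pairs a nonzero vector only with vectors independent of it. *)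
Lemma im_two_vectors s : s != 1%g ->
  exists x y, [/\ x \in im s, y \in im s & forall a b, a *: x + b *: y = 0 -> a = 0 /\ b = 0].
Proof.
move/im_neq0 => [x x_im x0]; have [y y_im xy] := omega_im_nondeg x_im x0.
exists x, y; split=> // a b ab0.
have b0 : b = 0.
  have := linear0r omega x; rewrite -ab0 linearDr !linearZr /= omega_diag.
  by rewrite mulr0 add0r => /eqP; rewrite mulf_eq0 (negPf xy) orbF => /eqP.
move: ab0; rewrite b0 scale0r addr0 => /eqP.
by rewrite scaler_eq0 (negPf x0) orbF => /eqP.
Qed.

(* The defining relations of H are x y - y x = sum over g of (kappa g x y) g.   *)
Definition kappa g x y : k :=
  omega x y *+ (g == 1%g)
  - (if g \in sympl_refl rho then c g * refl_form rho omega g x y else 0).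

Lemma kappa_linear g a u v y :
  kappa g (a *: u + v) y = a * kappa g u y + kappa g v y.
Proof.
rewrite /kappa /refl_form !linearP !linearPl /=.
case: (g == 1%g); case: ifP => _; rewrite ?mulr1n ?mulr0n; ring.
Qed.

Lemma kappa_anti g x y : kappa g x y = - kappa g y x.
Proof.
rewrite /kappa /refl_form (omega_anti x y) (omega_anti (pr g x)).
case: (g == 1%g); case: ifP => _; rewrite ?mulr1n ?mulr0n; ring.
Qed.

Lemma kappa_diag g x : kappa g x x = 0.
Proof.
by rewrite /kappa /refl_form !omega_diag mulr0 mul0rn if_same subrr.
Qed.

Lemma kappa_conj g h x y :
  kappa (h * g * h^-1)%g (rho h x) (rho h y) = kappa g x y.
Proof.
rewrite /kappa (refl_conj g h) /refl_form (pr_conj g h x) (pr_conj g h y).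
rewrite (omega_rho h x) (omega_rho h (pr g x)).
have -> : (h * g * h^-1 == 1)%g = (g == 1%g).
  by rewrite -eq_mulgV1 -[X in _ == X]mulg1 (inj_eq (mulgI h)).
case: ifP => // g_refl; congr (_ - _ * _).
by rewrite -(c_conj h^-1%g g_refl) conjgE invgK mulgA.
Qed.

(** For g = 1 the vectors vanish, for other non-reflections the coefficients. For a reflection only
    projections to the plane im(1 - g) matter, and in a plane [omega(x,y) z + omega(y,z) x +
    omega(z,x) y = 0]. *)
Lemma kappa_jacobi g x y z :
  kappa g x y *: (rho g z - z) + kappa g y z *: (rho g x - x)
  + kappa g z x *: (rho g y - y) = 0.
Proof.
have [->|g1] := eqVneq g 1%g.
  by rewrite lin_act1 !id_lfunE !subrr !scaler0 !addr0.
rewrite /kappa (negPf g1); case: ifP => [g_refl|_]; last first.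
  by rewrite subrr !scale0r !addr0.
have mv u : rho g u - u = (rho g - \1)%VF (pr g u).
  rewrite [in LHS](im_ker_split g u) linearD /=.
  have := memv_pi (ker g) (im g) u; rewrite fix_kerE => /eqP ->.
  by rewrite opprD addrACA subrr addr0 add_lfunE opp_lfunE id_lfunE.
rewrite !mv /refl_form; set f := (rho g - \1)%VF.
have [u [v [u_im v_im uv0]]] := im_two_vectors g1.
have uv_free : free [:: u; v].
  rewrite free_cons span_seq1 seq1_free; apply/andP; split.
    apply/negP => /vlineP[a Eu].
    have [|] := uv0 1 (- a); first by rewrite scale1r Eu scaleNr subrr.
    by move/eqP; rewrite oner_eq0.
  apply/eqP => v0; have [|_ /eqP] := uv0 0 1; last by rewrite oner_eq0.
  by rewrite scale0r v0 scaler0 addr0.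
(* The image has dimension two, so the independent vectors [u], [v] span it. *)
have span_uv w : exists a b, pr g w = a *: u + b *: v.
  have : basis_of (im g) [:: u; v].
    rewrite basisEfree uv_free /=; move: g_refl; rewrite inE => /eqP -> /=.
    rewrite andbT; apply/span_subvP => t; rewrite !inE.
    by case/orP => /eqP ->.
  move/span_basis => def_im.
  have : pr g w \in <<[:: u; v]>>%VS by rewrite def_im memv_pi.
  rewrite span_cons span_seq1 => /memv_addP[_ /vlineP[a ->]].
  by case=> _ /vlineP[b ->] Ew; exists a, b.
have omE a b a' b' :
    omega (a *: u + b *: v) (a' *: u + b' *: v) = (a * b' - b * a') * omega u v.
  rewrite linearDl !linearDr !linearZl !linearZr /= !omega_diag.
  by rewrite (omega_anti v u); ring.
have [ax [bx ->]] := span_uv x; have [ay [by' ->]] := span_uv y.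
have [az [bz ->]] := span_uv z.
rewrite !omE !mulr0n !sub0r; move: (omega u v) (c g) => w cg.
have fE a b : f (a *: u + b *: v) = a *: f u + b *: f v.
  by rewrite linearD !linearZ.
rewrite !fE !scalerDr !scalerA.
set A := f u; set B := f v.
transitivity ((0 : k) *: A + (0 : k) *: B); last by rewrite !scale0r addr0.
rewrite [X in X + _]addrACA -!scalerDl addrACA -!scalerDl.
by congr (_ *: _ + _ *: _); ring.
Qed.

End SymplecticAction.

(** * Normal forms in the quotient algebra *)

Section QuotientNormalForm.
Variables (k : fieldType) (V : vectType k) (gT : finGroupType).
Variables (rho : linear_action V gT) (kap : gT -> V -> V -> k).
Local Notation N := (\dim {:V}).
Local Notation S := {mpoly k[N]}.
Local Notation T := (tensor_skew_alg rho).

Hypothesis kap_linear : forall g a u v y,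
  kap g (a *: u + v) y = a * kap g u y + kap g v y.
Hypothesis kap_anti : forall g x y, kap g x y = - kap g y x.
Hypothesis kap_diag : forall g x, kap g x x = 0.
Hypothesis kap_conj : forall g h x y,
  kap (h * g * h^-1)%g (rho h x) (rho h y) = kap g x y.
Hypothesis kap_jacobi : forall g x y z,
  kap g x y *: (rho g z - z) + kap g y z *: (rho g x - x)
  + kap g z x *: (rho g y - y) = 0.

Variable rel : T -> Prop.
Hypothesis relE : forall z, rel z <-> exists x y,
  z = (skew_vect rho x * skew_vect rho y - skew_vect rho y * skew_vect rho x)
      - \sum_g kap g x y *: skew_group rho g.
Local Notation H := (quot_alg rel).

Definition nfw (h : gT) (u : seq V) : S := mlin_ext (nf rho kap (size u) h) u.

Lemma nfw_linear h p q a u v :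
  nfw h (p ++ (a *: u + v) :: q) = a *: nfw h (p ++ u :: q) + nfw h (p ++ v :: q).
Proof. by rewrite /nfw !size_cat /= mlin_ext_linear. Qed.

Lemma nfw_swap h a x y b :
  nfw h (a ++ x :: y :: b) - nfw h (a ++ y :: x :: b)
  = \sum_g kap g x y *: nfw (h * g^-1)%g (a ++ map (rho g) b).
Proof.
have nfs := nf_swapP kap_linear kap_anti kap_diag kap_conj kap_jacobi.
rewrite /nfw !size_cat /= !addnS nfs //; apply: eq_bigr => g _.
by rewrite size_cat size_map.
Qed.

Definition skew_nf (h : gT) (f : T) : S :=
  \sum_g tensor_ext (nfw (h * g^-1)%g) (f g).

Lemma skew_nf_linear h : linear (skew_nf h).
Proof.
move=> a x y; rewrite /skew_nf scaler_sumr -big_split; apply: eq_bigr => g _ /=.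
by rewrite !ffunE tensor_ext_linear //; apply: nfw_linear.
Qed.

HB.instance Definition _ h := GRing.isLinear.Build k T S _ (skew_nf h)
  (skew_nf_linear h).

Lemma skew_nf_word h u g : skew_nf h (sword rho u g) = nfw (h * g^-1)%g u.
Proof.
rewrite /skew_nf (bigD1 g) //= big1 => [|i /negPf ig].
  by rewrite ffunE eqxx addr0 tensor_ext_word //; apply: nfw_linear.
have t0 : tensor_ext (nfw (h * i^-1)%g) 0 = 0.
  have := tensor_ext_linear (nfw_linear (h * i^-1)%g) 1 0 0.
  rewrite !scale1r addr0 => /eqP.
  by rewrite -subr_eq0 opprD addNKr oppr_eq0 => /eqP.
by rewrite ffunE ig t0.
Qed.

(** Between [u g] and [v r] a relator becomes an exchange inside a word minus its contraction, which
    [nfw_swap] annihilates; conjugation by [g] moves the group elements of the relator past [g]. *)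
Lemma skew_nf_rel h z : in_ideal rel z -> skew_nf h z = 0.
Proof.
move=> Iz; suff E x y : skew_nf h (x * z * y) = 0.
  by rewrite -[z]mul1r -[1 * z]mulr1 E.
elim: Iz x y => {z} [z /relE[x0 [y0 Ez]]||z t _ IHz _ IHt|a z b _ IHz] x y.
- move: x y; elim/skew_alg_ind => [|b x1 x2 IH1 IH2|u g] y.
  + by rewrite !mul0r raddf0.
  + have -> : (b *: x1 + x2) * z * y = b *: (x1 * z * y) + x2 * z * y.
      by rewrite !mulrDl -!scalerAl.
    apply: etrans (skew_nf_linear h b _ _) _.
    apply: etrans (congr2 (fun s t => b *: s + t) (IH1 y) (IH2 y)) _.
    by rewrite scaler0 addr0.
  elim/skew_alg_ind: y => [|b y1 y2 IH1 IH2|v r].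
  + by rewrite mulr0 raddf0.
  + have -> : sword rho u g * z * (b *: y1 + y2)
        = b *: (sword rho u g * z * y1) + sword rho u g * z * y2.
      by rewrite mulrDr -scalerAr.
    apply: etrans (skew_nf_linear h b _ _) _.
    apply: etrans (congr2 (fun s t => b *: s + t) IH1 IH2) _.
    by rewrite scaler0 addr0.
  have E : sword rho u g * z * sword rho v r =
      sword rho (u ++ rho g x0 :: rho g y0 :: map (rho g) v) (g * r)
      - sword rho (u ++ rho g y0 :: rho g x0 :: map (rho g) v) (g * r)
      - \sum_s kap s x0 y0 *: sword rho (u ++ map (rho (g * s)%g) v) (g * s * r).
    rewrite Ez; apply: etrans (mulr_relation _ _ _ _ _ _) _.
    have EM w w' : sword rho u g * (skew_vect rho w * skew_vect rho w')
        * sword rho v r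
      = sword rho (u ++ rho g w :: rho g w' :: map (rho g) v) (g * r).
      rewrite !sword_vect !swordM lin_act1 /= id_lfunE !mulg1.
      by rewrite -catA.
    apply: (congr2 (fun s t => s - t) (congr2 (fun s t => s - t) (EM _ _) (EM _ _))).
    apply: eq_bigr => s _; congr (_ *: _).
    by rewrite sword_group !swordM /= cats0.
  rewrite E !raddfB [X in _ - X = _]raddf_sum /= !skew_nf_word nfw_swap.
  apply/eqP; rewrite subr_eq0; apply/eqP.
  rewrite (reindex_inj (conjg_inj g^-1%g)) /=; apply: eq_bigr => s _.
  rewrite linearZ /= skew_nf_word.
  rewrite conjgE invgK mulgA kap_conj; congr (_ *: nfw _ (_ ++ _)).
    by rewrite !invMg invgK !mulgA mulgKV.
  rewrite -map_comp; apply: eq_map => w /=.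
  by rewrite -comp_lfunE -lin_actM mulgKV.
- by rewrite mulr0 mul0r raddf0.
- have -> : x * (z + t) * y = x * z * y + x * t * y by rewrite mulrDr mulrDl.
  apply: etrans (raddfD _ _ _) _.
  exact: etrans (congr2 +%R (IHz x y) (IHt x y)) (addr0 0).
have E : x * (a * z * b) * y = (x * a) * z * (b * y).
  exact: mulr_regroup.
exact: etrans (congr1 (skew_nf h) E) (IHz (x * a) (b * y)).
Qed.

Definition hword (u : seq V) (g : gT) : H := quot_pi rel (sword rho u g).

Definition hnf (h : gT) (x : H) : S := skew_nf h (quot_repr x).

Lemma hnf_pi h z : hnf h (quot_pi rel z) = skew_nf h z.
Proof.
apply/eqP; rewrite -subr_eq0 -linearB; apply/eqP/skew_nf_rel.
exact: quot_repr_pi.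
Qed.

Lemma hnf_linear h : linear (hnf h).
Proof.
move=> a x y; rewrite -[x]quot_reprK -[y]quot_reprK -linearP.
by rewrite !hnf_pi linearP.
Qed.

Lemma hnf_word h u g : hnf h (hword u g) = nfw (h * g^-1)%g u.
Proof. by rewrite hnf_pi skew_nf_word. Qed.

Lemma hword_ind (P : H -> Prop) :
  P 0 -> (forall a x y, P x -> P y -> P (a *: x + y)) ->
  (forall u g, P (hword u g)) -> forall x, P x.
Proof.
move=> P0 PD Pu x; rewrite -[x]quot_reprK.
elim/skew_alg_ind: (quot_repr x) => [|a y z Py Pz|u g].
- by rewrite quot_pi0.
- by rewrite quot_piD quot_piZ; apply: PD.
exact: Pu.
Qed.

Lemma hwordM u g v h :
  hword u g * hword v h = hword (u ++ map (rho g) v) (g * h)%g.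
Proof. by rewrite -quot_piM swordM. Qed.

Lemma hword_linear p q a u v g :
  hword (p ++ (a *: u + v) :: q) g = a *: hword (p ++ u :: q) g + hword (p ++ v :: q) g.
Proof.
rewrite /hword -quot_piZ -quot_piD -skew_elem_linear /sword /tword.
congr (quot_pi _ (skew_elem _ _ _)); rewrite !big_cat !big_cons /= linearP /=.
by rewrite mulrDl mulrDr -scalerAl -scalerAr.
Qed.

Lemma hword_swap a x y b g :
  hword (a ++ x :: y :: b) g - hword (a ++ y :: x :: b) g
  = \sum_s kap s x y *: hword (a ++ map (rho s) b) (s * g)%g.
Proof.
have rel0 : in_ideal rel
   ((skew_vect rho x * skew_vect rho y - skew_vect rho y * skew_vect rho x)
      - \sum_g kap g x y *: skew_group rho g).
  by apply: in_ideal_gen; apply/relE; exists x, y.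
have := in_idealM (sword rho a 1%g) (sword rho b g) rel0.
rewrite (mulr_relation _ _ _ _ (kap^~ x ^~ y) (skew_group rho)) => I0.
have E w w' : sword rho a 1%g * (skew_vect rho w * skew_vect rho w')
    * sword rho b g = sword rho (a ++ w :: w' :: b) g.
  have m1 t : [seq rho 1%g i | i <- t] = t.
    by rewrite -[RHS]map_id; apply: eq_map => i; rewrite lin_act1 id_lfunE.
  by rewrite !sword_vect !swordM !mul1g !m1 -!catA.
have E' s : sword rho a 1%g * skew_group rho s * sword rho b g
    = sword rho (a ++ map (rho s) b) (s * g)%g.
  by rewrite sword_group !swordM /= cats0 mul1g.
have I1 := eq_ind _ (in_ideal rel) I0 _ (congr2 (fun s t => s - t)
  (congr2 (fun s t => s - t) (E x y) (E y x))
  (eq_bigr _ (fun s _ => congr1 (fun t => kap s x y *: t) (E' s)))).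
move: I1; rewrite -[X in in_ideal _ X]subr0 => /quot_piP.
rewrite (linear_relation (quot_pi rel)) quot_pi0 => /eqP.
by rewrite subr_eq0 => /eqP.
Qed.

End QuotientNormalForm.

(** * The PBW filtration and the corner algebra *)

Section SortedWords.
Variable n : nat.

Definition mon_word (m : 'X_{1..n}) : seq 'I_n :=
  isort (@le_ord n) (flatten [seq nseq (m i) i | i <- enum 'I_n]).

Lemma count_mon_word m i : count_mem i (mon_word m) = m i.
Proof.
rewrite (seq.permP (perm_isort _ _)) count_flatten -map_comp sumnE big_map big_enum /=.
rewrite (bigD1 i) //= count_nseq /= eqxx mul1n big1 ?addn0 // => j ji.
by rewrite count_nseq /= (negPf ji).
Qed.

Lemma mon_word_sorted m : sorted (@le_ord n) (mon_word m).
Proof. exact: isort_sorted (@le_ord_total n) (@le_ord_trans n) _. Qed.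

Lemma mon_wordK w : mon_word [multinom count_mem i w | i < n] = isort (@le_ord n) w.
Proof.
apply: eq_isort; [exact: le_ord_total|exact: le_ord_trans|exact: le_ord_anti|].
apply/allP => i _ /=; rewrite -(seq.permP (perm_isort (@le_ord n) _)).
by rewrite count_mon_word mnmE.
Qed.

Lemma size_mon_word m : size (mon_word m) = mdeg m.
Proof.
rewrite (perm_size (perm_isort _ _)) size_flatten /shape -map_comp sumnE.
rewrite big_map big_enum mdegE; apply: eq_bigr => i _ /=.
by rewrite size_nseq.
Qed.

End SortedWords.

(** * The basis of sorted words and the filtration by degree *)

Section FilteredAlgebra.
Variables (k : fieldType) (V : vectType k) (gT : finGroupType).
Variable rho : linear_action V gT.
Local Notation N := (\dim {:V}).
Local Notation S := {mpoly k[N]}.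

Lemma word_mon_mon_word (m : 'X_{1..N}) : word_mon (mon_word m) = 'X_[m] :> S.
Proof.
rewrite /word_mon (perm_big _ (perm_isort _ _)) big_flatten big_map /=.
rewrite big_enum mpolyXE_id; apply: eq_bigr => i _ /=.
by rewrite big_nseq -Monoid.iteropE.
Qed.

Variables (kap : gT -> V -> V -> k) (nfw : gT -> seq V -> S).
Hypothesis nfw_lead : forall h u,
  (msize (nfw h u - vword_mon u *+ (h == 1%g)) <= size u)%N.
Hypothesis nfw_sorted : forall h w, sorted (@le_ord N) w ->
  nfw h (map vb w) = word_mon w *+ (h == 1%g).

(* [hw c u g] stands for the element c u g and [hnf h x] for the component at h *)
(* of the normal form of x. The algebra is kept abstract because unification    *)
(* tends to unfold the product of the concrete quotient.                        *)
Variables (H : pzRingType) (hw : k -> seq V -> gT -> H) (hnf : gT -> H -> S).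
Hypothesis hnfB : forall h x y, hnf h (x - y) = hnf h x - hnf h y.
Hypothesis hnf_word : forall h c u g, hnf h (hw c u g) = c *: nfw (h * g^-1)%g u.
Hypothesis hwM : forall c u g d v h,
  hw c u g * hw d v h = hw (c * d) (u ++ map (rho g) v) (g * h)%g.
Hypothesis hwD : forall c d u g, hw (c + d) u g = hw c u g + hw d u g.
Hypothesis hw_linear : forall c p a u v q g,
  hw c (p ++ (a *: u + v) :: q) g = hw (c * a) (p ++ u :: q) g + hw c (p ++ v :: q) g.
Hypothesis hw_swap : forall c a x y b g,
  hw c (a ++ x :: y :: b) g - hw c (a ++ y :: x :: b) g
  = \sum_s hw (c * kap s x y) (a ++ map (rho s) b) (s * g)%g.
Hypothesis hw_ind : forall P : H -> Prop,
  P 0 -> (forall x y, P x -> P y -> P (x + y)) ->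
  (forall c u g, P (hw c u g)) -> forall x, P x.

Lemma hnf0 h : hnf h 0 = 0.
Proof. by rewrite -(subrr 0) hnfB subrr. Qed.

Lemma hnfN h x : hnf h (- x) = - hnf h x.
Proof. by rewrite -sub0r hnfB hnf0 sub0r. Qed.

Lemma hnfD h x y : hnf h (x + y) = hnf h x + hnf h y.
Proof. by rewrite -{1}[y]opprK hnfB hnfN opprK. Qed.

Lemma hnf_sum h (I : Type) (r : seq I) (P : pred I) F :
  hnf h (\sum_(i <- r | P i) F i) = \sum_(i <- r | P i) hnf h (F i).
Proof. by apply: big_morph; [apply: hnfD | apply: hnf0]. Qed.

Lemma hw0 u g : hw 0 u g = 0.
Proof. by apply: (addrI (hw 0 u g)); rewrite -hwD !addr0. Qed.

Lemma hw_vect0 c p q g : hw c (p ++ 0 :: q) g = 0.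
Proof.
have := hw_linear c p 1 0 0 q g; rewrite scaler0 addr0 mulr1 => /eqP.
by rewrite -subr_eq0 opprD addNKr oppr_eq0 => /eqP.
Qed.

Definition from_nf1 (g : gT) (p : S) : H :=
  \sum_(m <- msupp p) hw p@_m (map vb (mon_word m)) g.

Definition from_nf (f : gT -> S) : H := \sum_g from_nf1 g (f g).

Lemma from_nf1w g K p : (msize p <= K)%N ->
  from_nf1 g p = \sum_(m : 'X_{1..N < K}) hw p@_m (map vb (mon_word m)) g.
Proof.
move=> le_pK; pose I : subFinType _ := 'X_{1..N < K}.
rewrite /from_nf1 (big_mksub I) //=; first last.
- by move=> x /msize_mdeg_lt /leq_trans; apply.
- by rewrite msupp_uniq.
by rewrite big_rmcond //= => i /memN_msupp_eq0 ->; rewrite hw0.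
Qed.

Lemma from_nf1D g p q : from_nf1 g (p + q) = from_nf1 g p + from_nf1 g q.
Proof.
have [K [pK qK pqK]] : exists K, [/\ msize p <= K, msize q <= K & msize (p + q) <= K]%N.
  exists (maxn (msize p) (msize q)); rewrite leq_maxl leq_maxr; split=> //.
  exact: msizeD_le.
rewrite (from_nf1w g pK) (from_nf1w g qK) (from_nf1w g pqK) -big_split.
by apply: eq_bigr => m _; rewrite mcoeffD hwD.
Qed.

Lemma hnf_from_nf h f : hnf h (from_nf f) = f h.
Proof.
rewrite hnf_sum (bigD1 h) //= big1 ?addr0 => [|g gh].
  rewrite hnf_sum [RHS]mpolyE; apply: eq_bigr => m _.
  rewrite hnf_word nfw_sorted; last exact: mon_word_sorted.
  by rewrite mulgV eqxx word_mon_mon_word.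
rewrite hnf_sum big1 // => m _.
rewrite hnf_word nfw_sorted; last exact: mon_word_sorted.
by rewrite -eq_mulgV1 eq_sym (negPf gh) scaler0.
Qed.

Definition in_range (x : H) := exists f, x = from_nf f.

Lemma in_range0 : in_range 0.
Proof.
exists (fun=> 0); rewrite /from_nf big1 // => g _.
by rewrite /from_nf1 msupp0 big_nil.
Qed.

Lemma in_rangeD x y : in_range x -> in_range y -> in_range (x + y).
Proof.
case=> f -> [f' ->]; exists (fun g => f g + f' g).
by rewrite -big_split; apply: eq_bigr => g _; rewrite from_nf1D.
Qed.

Lemma in_range_sorted c g (w : seq 'I_N) :
  in_range (hw c (map vb (isort (@le_ord N) w)) g).
Proof.
rewrite -mon_wordK; set m := [multinom _ | _ < _].
exists (fun h => (c *: 'X_[m]) *+ (h == g)).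
rewrite /from_nf (bigD1 g) //= big1 ?addr0 => [|h /negPf ->]; last first.
  by rewrite mulr0n /from_nf1 msupp0 big_nil.
rewrite eqxx mulr1n (@from_nf1w _ (mdeg m).+1); last first.
  by apply: leq_trans (msizeZ_le _ _) _; rewrite msizeX.
rewrite (bigD1 (BMultinom (leqnn (mdeg m).+1))) //= big1 ?addr0.
  by rewrite mcoeffZ mcoeffX eqxx mulr1.
move=> m' ne; rewrite mcoeffZ mcoeffX.
case: eqP => [E|_]; last by rewrite mulr0 hw0.
by case/eqP: ne; apply: val_inj; rewrite /= -E.
Qed.

(** Sorting a word changes it by shorter words, which are in the range by induction on the
    length. *)
Lemma in_range_word c u g : in_range (hw c u g).
Proof.
have [n] := ubnP (size u); elim: n => // n IHn in c u g *; rewrite ltnS => sz.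
apply: (@vword_ind _ _ (size u) (fun u => forall c, in_range (hw c u g))) => //.
- by move=> p q d; rewrite hw_vect0; apply: in_range0.
- by move=> a x y p q Qx Qy d; rewrite hw_linear; apply: in_rangeD.
move=> w0 szw0 {}c; have IH a x y b : (size a + size b).+2 = size u ->
    in_range (hw c (map vb (a ++ y :: x :: b)) g) ->
    in_range (hw c (map vb (a ++ x :: y :: b)) g).
  move=> szab; rewrite !map_cat /= => Q.
  rewrite -[hw c _ g](subrK (hw c (map vb a ++ [:: vb y, vb x & map vb b]) g)).
  apply: in_rangeD Q; rewrite hw_swap.
  elim/big_rec: _ => [|s z _ Qz]; first exact: in_range0.
  apply: in_rangeD Qz; apply: IHn.
  by rewrite size_cat !size_map; lia.
have ins p x w : (size p + size w).+1 = size u ->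
    in_range (hw c (map vb (p ++ insert (@le_ord N) x w)) g) ->
    in_range (hw c (map vb (p ++ x :: w)) g).
  elim: w p => //= y w IHw p szp; case: ifP => // _ Q; apply: IH.
    by move: szp; lia.
  by rewrite -cat_rcons; apply: IHw; rewrite ?size_rcons ?cat_rcons //; lia.
suff srt w p : (size p + size w)%N = size u ->
    in_range (hw c (map vb (p ++ isort (@le_ord N) w)) g) ->
    in_range (hw c (map vb (p ++ w)) g).
  exact: (srt w0 [::] szw0 (in_range_sorted c g w0)).
elim: w p => //= x w IHw p szp Q; rewrite -cat_rcons; apply: IHw.
  by rewrite size_rcons; lia.
rewrite cat_rcons; apply: ins Q.
by rewrite (perm_size (perm_isort _ _)) -addnS.
Qed.

(** Together with [hnf_from_nf] this is PBW: sorted words times group elements form a basis. *)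
Lemma from_nfK x : from_nf (fun h => hnf h x) = x.
Proof.
have [f ->] : in_range x.
  apply: hw_ind x; [exact: in_range0 | exact: in_rangeD | exact: in_range_word].
by rewrite /from_nf; apply: eq_bigr => g _; rewrite hnf_from_nf.
Qed.

Definition fil (n : nat) (x : H) := forall h, (msize (hnf h x) <= n)%N.

Lemma fil_ind n (P : H -> Prop) x :
  fil n x -> P 0 -> (forall x y, P x -> P y -> P (x + y)) ->
  (forall c u g, (size u < n)%N -> P (hw c u g)) -> P x.
Proof.
move=> xn P0 PD Pu; rewrite -[x]from_nfK /from_nf.
elim/big_rec: _ => // g y _ Py; apply: (PD _ _ _ Py).
rewrite /from_nf1 big_seq; elim/big_rec: _ => // m z mx Pz; apply: (PD _ _ _ Pz).
apply: Pu; rewrite size_map size_mon_word.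
exact: leq_trans (msize_mdeg_lt mx) (xn g).
Qed.

Lemma msizeM_leq a b (p q : S) :
  (msize p <= a -> msize q <= b -> msize (p * q) <= (a + b).-1)%N.
Proof.
move=> pa qb; have [->|p0] := eqVneq p 0; first by rewrite mul0r msize0.
have [->|q0] := eqVneq q 0; first by rewrite mulr0 msize0.
by rewrite msizeM // -!subn1 leq_sub2r // leq_add.
Qed.

Definition pact (g : gT) (p : S) : S :=
  p \mPo [tuple vlin (rho g (vb i)) | i < N].

HB.instance Definition _ g := GRing.RMorphism.copy (pact g)
  (comp_mpoly [tuple vlin (rho g (vb i)) | i < N]).

Lemma pactZ g c p : pact g (c *: p) = c *: pact g p.
Proof. exact: comp_mpolyZ. Qed.

Lemma pact1 p : pact 1 p = p.
Proof.
rewrite -[RHS]comp_mpoly_id; congr (p \mPo _); apply: eq_from_tnth => i.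
by rewrite !tnth_mktuple lin_act1 id_lfunE vlin_vb.
Qed.

Lemma pact_vlin g v : pact g (vlin v) = vlin (rho g v).
Proof.
rewrite [in RHS](vb_sum v) linear_sum linear_sum /vlin /lform raddf_sum /=.
apply: eq_bigr => i _; rewrite pactZ linearZ /= linearZ /=.
by rewrite /pact comp_mpolyXU -tnth_nth tnth_mktuple.
Qed.

Lemma pact_vword g u : pact g (vword_mon u) = vword_mon (map (rho g) u).
Proof.
rewrite /vword_mon rmorph_prod big_map; apply: eq_bigr => v _.
exact: pact_vlin.
Qed.

Lemma vword_mon_vb w : vword_mon (map vb w) = word_mon w :> S.
Proof.
by rewrite /vword_mon big_map; apply: eq_bigr => i _; rewrite vlin_vb.
Qed.

Lemma msize_pact g p : (msize (pact g p) <= msize p)%N.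
Proof.
rewrite [p in pact g p]mpolyE raddf_sum /= big_seq; apply: msize_sum_leq => m mp.
rewrite pactZ; apply: leq_trans (msizeZ_le _ _) _.
rewrite -word_mon_mon_word -vword_mon_vb pact_vword.
apply: leq_trans (dhomog_msize_leq (vword_mon_homog _)) _.
by rewrite !size_map size_mon_word; apply: msize_mdeg_lt.
Qed.

Lemma nfw_msize h u : (msize (nfw h u) <= (size u).+1)%N.
Proof.
rewrite -[nfw h u](subrK (vword_mon u *+ (h == 1%g))).
apply: msizeD_leq; first exact: leq_trans (nfw_lead h u) (leqnSn _).
case: eqP => _; last by rewrite mulr0n msize0.
exact: dhomog_msize_leq (vword_mon_homog u).
Qed.

(** The product of the skew group ring over [S], taken on normal forms. *)
Definition conv x y h := \sum_g hnf g x * pact g (hnf (g^-1 * h)%g y).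

Lemma hnfM_word c u g d v r h :
  (msize (hnf h (hw c u g * hw d v r) - conv (hw c u g) (hw d v r) h)
    <= size u + size v)%N.
Proof.
pose A s : S := c *: (vword_mon u *+ (s * g^-1 == 1)%g).
pose B s : S := d *: (vword_mon v *+ (s^-1 * h * r^-1 == 1)%g).
have AE s : (msize (hnf s (hw c u g) - A s) <= size u)%N.
  by rewrite hnf_word -scalerBr; apply: leq_trans (msizeZ_le _ _) (nfw_lead _ _).
have BE s : (msize (hnf (s^-1 * h)%g (hw d v r) - B s) <= size v)%N.
  by rewrite hnf_word -scalerBr; apply: leq_trans (msizeZ_le _ _) (nfw_lead _ _).
have ABE : \sum_s A s * pact s (B s)
    = (c * d) *: (vword_mon (u ++ map (rho g) v) *+ (h * (g * r)^-1 == 1)%g).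
  rewrite (bigD1 g) //= big1 ?addr0 => [|s sg]; last first.
    by rewrite /A -eq_mulgV1 (negPf sg) mulr0n scaler0 mul0r.
  rewrite /A /B mulgV eqxx mulr1n pactZ -scalerAl -scalerAr scalerA.
  congr (_ *: _); rewrite raddfMn /= pact_vword mulrnAr; congr (_ *+ _).
    by rewrite /vword_mon big_cat.
  by rewrite -eq_mulgV1 -[in RHS]eq_mulgV1 (can2_eq (mulKVg g) (mulKg g)).
(* [t] multiplies the leading monomials alone; the true product and [conv] are both compared with
   it. *)
set t := \sum_s _ in ABE.
have splitB (p q : S) : p - q = (p - t) - (q - t) by ring.
rewrite splitB; apply: msizeB_leq.
  rewrite ABE hwM hnf_word -scalerBr; apply: leq_trans (msizeZ_le _ _) _.
  by apply: leq_trans (nfw_lead _ _) _; rewrite size_cat size_map.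
rewrite /conv /t -sumrB; apply: msize_sum_leq => s _.
set a := hnf s _; set b := hnf _ _.
have -> : a * pact s b - A s * pact s (B s)
    = (a - A s) * pact s b + A s * pact s (b - B s).
  by rewrite raddfB /=; ring.
apply: msizeD_leq.
  apply: leq_trans (msizeM_leq (AE s) (leq_trans (msize_pact s b) _)) _.
    by rewrite /b hnf_word; apply: leq_trans (msizeZ_le _ _) (nfw_msize _ v).
  by rewrite addnS.
have As : (msize (A s) <= (size u).+1)%N.
  apply: leq_trans (msizeZ_le _ _) _; case: eqP => _; last by rewrite mulr0n msize0.
  exact: dhomog_msize_leq (vword_mon_homog u).
by apply: leq_trans (msizeM_leq As (leq_trans (msize_pact s _) (BE s))) _.
Qed.

(** Factors of degrees less than [n] and [m] have a product of degree at most [n + m - 2]; in that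
    degree it is computed by [conv]. Additivity reduces the claim to words. *)
Lemma hnfM n m x y h : fil n x -> fil m y ->
  (msize (hnf h (x * y) - conv x y h) <= n + m - 2)%N.
Proof.
move=> xn ym.
have c0l z : conv 0 z h = 0.
  by rewrite /conv big1 // => g _; rewrite hnf0 mul0r.
have c0r z : conv z 0 h = 0.
  by rewrite /conv big1 // => g _; rewrite hnf0 raddf0 mulr0.
have cDl x1 x2 z : conv (x1 + x2) z h = conv x1 z h + conv x2 z h.
  by rewrite -big_split; apply: eq_bigr => g _; rewrite hnfD mulrDl.
have cDr x1 x2 z : conv z (x1 + x2) h = conv z x1 h + conv z x2 h.
  by rewrite -big_split; apply: eq_bigr => g _; rewrite hnfD raddfD mulrDr.
pose P z := (msize (hnf h (z * y) - conv z y h) <= n + m - 2)%N : Prop.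
apply: (@fil_ind n P x xn) => [|x1 x2 P1 P2|c u g szu].
- by rewrite /P mul0r hnf0 c0l subr0 msize0.
- by rewrite /P mulrDl hnfD cDl opprD addrACA; apply: msizeD_leq.
pose Q z := (msize (hnf h (hw c u g * z) - conv (hw c u g) z h) <= n + m - 2)%N : Prop.
apply: (@fil_ind m Q y ym) => [|x1 x2 P1 P2|d v r szv].
- by rewrite /Q mulr0 hnf0 c0r subr0 msize0.
- by rewrite /Q (mulrDr (hw c u g)) hnfD cDr opprD addrACA; exact: (msizeD_leq P1 P2).
by apply: leq_trans (hnfM_word c u g d v r h) _; lia.
Qed.

Lemma fil_leq n m x : (n <= m)%N -> fil n x -> fil m x.
Proof. by move=> nm xn h; apply: leq_trans (xn h) nm. Qed.

Lemma filB n x y : fil n x -> fil n y -> fil n (x - y).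
Proof. by move=> xn yn h; rewrite hnfB; apply: msizeB_leq. Qed.

Lemma filD n x y : fil n x -> fil n y -> fil n (x + y).
Proof. by move=> xn yn h; rewrite hnfD; apply: msizeD_leq. Qed.

Lemma fil_zero n : fil n 0.
Proof. by move=> h; rewrite hnf0 msize0. Qed.

Lemma fil0P x : fil 0 x -> x = 0.
Proof.
move=> x0; have [f0 Ef0] := in_range0; rewrite -[x]from_nfK Ef0.
apply: eq_bigr => g _; congr from_nf1.
rewrite -hnf_from_nf -Ef0 hnf0; apply/eqP; rewrite -msize_poly_eq0 -leqn0.
exact: x0.
Qed.

Lemma fil_exists x : exists n, fil n x.
Proof.
exists (\max_g msize (hnf g x)) => h.
exact: (leq_bigmax (F := fun g => msize (hnf g x))).
Qed.

Lemma filM n m x y : fil n x -> fil m y -> fil (n + m).-1 (x * y).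
Proof.
move=> xn ym h; rewrite -[hnf h _](subrK (conv x y h)); apply: msizeD_leq.
  by apply: leq_trans (hnfM h xn ym) _; lia.
apply: msize_sum_leq => g _; apply: msizeM_leq => //.
exact: leq_trans (msize_pact _ _) (ym _).
Qed.

Lemma msize_mulr_homog m d (p D : S) : D != 0 -> D \is d.-homog ->
  (msize (p * D) <= m + d)%N -> (msize p <= m)%N.
Proof.
move=> D0 /dhomogP hD; have [->|p0] := eqVneq p 0; first by rewrite msize0.
by rewrite msizeM // -(mlead_deg D0) hD ?mlead_supp // addnS leq_add2r.
Qed.

(* [d] has an invariant polynomial [D] of degree [n] as its symbol, and so     *)
(* commutes with all of H up to lower order terms.                             *)
Definition symbol (d : H) (n : nat) (D : S) :=
  [/\ D \is n.-homog, D != 0, forall g, pact g D = D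
    & forall h, (msize (hnf h d - D *+ (h == 1%g)) <= n)%N].

(** * Multiplication by an element with invariant symbol *)

Section Symbol.
Variables (d : H) (n : nat) (D : S).
Hypothesis dD : symbol d n D.

Lemma symbol_fil : fil n.+1 d.
Proof.
have [D_homog _ _ d_lead] := dD => h.
rewrite -[hnf h d](subrK (D *+ (h == 1%g))).
apply: msizeD_leq; first exact: leq_trans (d_lead h) (leqnSn n).
case: eqP => _; last by rewrite mulr0n msize0.
exact: dhomog_msize_leq.
Qed.

Lemma symbol_mulr m x h : fil m x ->
  (msize (hnf h (x * d) - hnf h x * D) <= (m + n).-1)%N.
Proof.
have [_ _ D_inv d_lead] := dD => xm.
rewrite -[X in msize X](subrKA (conv x d h)); apply: msizeD_leq.
  by apply: leq_trans (hnfM h xm symbol_fil) _; lia.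
have -> : hnf h x * D = \sum_g hnf g x * pact g (D *+ (g^-1 * h == 1)%g).
  rewrite (bigD1 h) //= big1 ?addr0 => [|g gh]; first by rewrite mulVg eqxx D_inv.
  by rewrite -eq_mulVg1 (negPf gh) raddf0 mulr0.
rewrite -sumrB; apply: msize_sum_leq => g _; rewrite -mulrBr -raddfB.
by apply: msizeM_leq => //; apply: leq_trans (msize_pact _ _) _.
Qed.

Lemma symbol_mull m x h : fil m x ->
  (msize (hnf h (d * x) - D * hnf h x) <= (m + n).-1)%N.
Proof.
have [_ _ D_inv d_lead] := dD => xm.
rewrite -[X in msize X](subrKA (conv d x h)); apply: msizeD_leq.
  by apply: leq_trans (hnfM h symbol_fil xm) _; lia.
have -> : D * hnf h x = \sum_g (D *+ (g == 1)%g) * pact g (hnf (g^-1 * h)%g x).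
  rewrite (bigD1 1%g) //= big1 ?addr0 => [|g /negPf ->].
    by rewrite eqxx invg1 mul1g mulr1n pact1.
  by rewrite mulr0n mul0r.
rewrite -sumrB; apply: msize_sum_leq => g _; rewrite -mulrBl.
rewrite addnC; apply: msizeM_leq => //.
by apply: leq_trans (msize_pact _ _) _.
Qed.

Lemma symbol_comm m x : fil m x -> fil (m + n).-1 (x * d - d * x).
Proof.
move=> xm h; have -> : hnf h (x * d - d * x)
    = (hnf h (x * d) - hnf h x * D) - (hnf h (d * x) - D * hnf h x).
  by rewrite hnfB; ring.
by apply: msizeB_leq; [apply: symbol_mulr | apply: symbol_mull].
Qed.

(** Multiplication by [D] raises degrees in the domain [S] by exactly [n], so a product of too small
    a degree comes from an [x] of too small a degree. *)
Lemma symbol_lower_r m x : fil m x -> fil (m + n).-1 (x * d) -> fil m.-1 x.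
Proof.
have [D_homog D0 _ _] := dD.
case: m => // m xm xdm h; apply: (msize_mulr_homog D0 D_homog).
rewrite -[hnf h x * D](subKr (hnf h (x * d))).
by apply: msizeB_leq; [apply: xdm | apply: (symbol_mulr h xm)].
Qed.

Lemma symbol_lower_l m x : fil m x -> fil (m + n).-1 (d * x) -> fil m.-1 x.
Proof.
have [D_homog D0 _ _] := dD.
case: m => // m xm xdm h; apply: (msize_mulr_homog D0 D_homog).
rewrite mulrC -[D * hnf h x](subKr (hnf h (d * x))).
by apply: msizeB_leq; [apply: xdm | apply: (symbol_mull h xm)].
Qed.

Lemma symbol_reg_r x : x * d = 0 -> x = 0.
Proof.
move=> xd; have [m] := fil_exists x; elim: m => [|m IHm xm]; first exact: fil0P.
by apply: IHm; apply: (symbol_lower_r xm); rewrite xd; apply: fil_zero.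
Qed.

Lemma symbol_reg_l x : d * x = 0 -> x = 0.
Proof.
move=> xd; have [m] := fil_exists x; elim: m => [|m IHm xm]; first exact: fil0P.
by apply: IHm; apply: (symbol_lower_l xm); rewrite xd; apply: fil_zero.
Qed.

End Symbol.

Lemma msize_sub_pihomog d (p : S) : (msize p <= d.+1)%N ->
  (msize (p - pihomog mdeg d p) <= d)%N.
Proof.
move=> pd; rewrite {1}(pihomog_partitionE pd) big_ord_recr /= addrK.
apply: msize_sum_leq => i _.
exact: leq_trans (dhomog_msize_leq (pihomogP _ _ _)) (ltn_ord i).
Qed.

Lemma pihomog_low d (p : S) : (msize p <= d)%N -> pihomog mdeg d p = 0.
Proof.
move=> pd; rewrite pihomogE big_seq_cond big_pred0 // => m.
apply/negP => /andP[/msize_mdeg_lt mp /eqP Em].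
by move: mp; rewrite Em ltnNge pd.
Qed.

Lemma pihomogMr d n (p D : S) : (msize p <= d.+1)%N -> D \is n.-homog ->
  pihomog mdeg (d + n) (p * D) = pihomog mdeg d p * D.
Proof.
move=> pd hD; rewrite -{1}[p](subrK (pihomog mdeg d p)) mulrDl raddfD /=.
rewrite pihomog_low ?add0r; last first.
  apply: leq_trans (msizeM_leq (msize_sub_pihomog pd) (dhomog_msize_leq hD)) _.
  by rewrite addnS.
by rewrite pihomog_dE //; apply: dhomogM hD; apply: pihomogP.
Qed.

(** [R] stands for the graph of a map raising degrees by at most [i - j]. The subtraction is
    truncated: once [n + i <= j], the bound forces [y = 0]. *)
Definition bounded_by (R : H -> H -> Prop) i j :=
  forall x y n, R x y -> fil n x -> fil (n + i - j) y.

(** * Lowering the degree of a module map *)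

Section Descent.
Variables (d1 d2 : H) (n : nat) (D1 D2 : S).
Hypotheses (d1D : symbol d1 n D1) (d2D : symbol d2 n D2).
Hypothesis D_coprime : forall p q : S, p * D2 = q * D1 -> exists t, p = t * D1.

(** Let f have graph [R]. Since f(d1) d2 - f(d2) d1 = f(d1 d2 - d2 d1) has too small a degree, [D1]
    divides the top part of f(d1); [z] lifts the quotient. For f' = f - z the value f'(d1) drops in
    degree, hence so does f'(x) d1 = f'(d1) x + f'(x d1 - d1 x), and with it f'(x). *)
Lemma descent_step (R : H -> H -> Prop) i j y1 y2 :
  (forall x y x' y', R x y -> R x' y' -> R (x - x') (y - y')) ->
  (forall x y a, R x y -> R (x * a) (y * a)) ->
  (forall y, R 0 y -> y = 0) ->
  R d1 y1 -> R d2 y2 -> bounded_by R i j ->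
  exists z, bounded_by (fun x y => R x (y + z * x)) i j.+1.
Proof.
move=> RB RM R0 Ry1 Ry2 bR.
have [D1_homog D1_neq0 _ _] := d1D; have [D2_homog _ _ _] := d2D.
set m := (n.+1 + i - j)%N.
have y1m : fil m y1 := bR _ _ _ Ry1 (symbol_fil d1D).
have y2m : fil m y2 := bR _ _ _ Ry2 (symbol_fil d2D).
have [z [zm y1z]] : exists z, fil (m - n) z /\ fil m.-1 (y1 - z * d1).
  have [m0|m_gt0] := posnP m.
    have y10 : y1 = 0 by apply: fil0P; move: y1m; rewrite m0.
    by exists 0; split; rewrite ?mul0r ?subr0 ?y10; apply: fil_zero.
  have top h : exists t, pihomog mdeg m.-1 (hnf h y1) = t * D1.
    apply: (D_coprime (q := pihomog mdeg m.-1 (hnf h y2))).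
    apply/eqP; rewrite -subr_eq0 -(pihomogMr _ D2_homog) ?prednK //.
    rewrite -(pihomogMr _ D1_homog) ?prednK // -raddfB; apply/eqP.
    apply: pihomog_low.
    have -> : hnf h y1 * D2 - hnf h y2 * D1 = hnf h (y1 * d2 - y2 * d1)
       - (hnf h (y1 * d2) - hnf h y1 * D2) + (hnf h (y2 * d1) - hnf h y2 * D1).
      by rewrite hnfB; ring.
    have E : (m.-1 + n = (m + n).-1)%N by lia.
    rewrite E; apply: msizeD_leq; last exact: symbol_mulr.
    apply: msizeB_leq; last exact: symbol_mulr.
    have := bR _ _ _ (RB _ _ _ _ (RM _ _ d2 Ry1) (RM _ _ d1 Ry2))
      (symbol_comm d2D (symbol_fil d1D)) h.
    by move/leq_trans; apply; move: m_gt0; rewrite /m; lia.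
  have [t tP] := fin_all_exists top.
  have tm h : (msize (t h) <= m - n)%N.
    apply: (msize_mulr_homog D1_neq0 D1_homog); rewrite -tP.
    by apply: leq_trans (dhomog_msize_leq (pihomogP _ _ _)) _; lia.
  exists (from_nf t); split=> [h|]; first by rewrite hnf_from_nf.
  have zm : fil (m - n) (from_nf t) by move=> h; rewrite hnf_from_nf.
  (* If [m <= n], the truncated bound [m - n] is 0: then [z] and [t] vanish, and so does the top
     part of [y1]. *)
  have [mn|nm] := leqP m n.
    have z0 : from_nf t = 0.
      by apply: fil0P; apply: fil_leq zm; lia.
    rewrite z0 mul0r subr0 => h; have t0 : t h = 0.
      by rewrite -(hnf_from_nf h t) z0 hnf0.
    have := @msize_sub_pihomog m.-1 (hnf h y1).
    by rewrite tP t0 mul0r subr0 prednK // => ->.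
  move=> h; have -> : hnf h (y1 - from_nf t * d1)
      = (hnf h y1 - pihomog mdeg m.-1 (hnf h y1))
        - (hnf h (from_nf t * d1) - hnf h (from_nf t) * D1).
    by rewrite hnfB tP hnf_from_nf; ring.
  apply: msizeB_leq.
    by apply: msize_sub_pihomog; rewrite prednK.
  by apply: leq_trans (symbol_mulr d1D h zm) _; lia.
exists z.
have bRz : bounded_by (fun x y => R x (y + z * x)) i j.
  move=> x y l Rxy xl; rewrite -[y](addrK (z * x)); apply: filB.
    exact: bR Rxy xl.
  have [mn|nm] := leqP m n.
    have -> : z = 0 by apply: fil0P; apply: fil_leq zm; lia.
    by rewrite mul0r; apply: fil_zero.
  by apply: fil_leq (filM zm xl); rewrite /m in nm *; lia.
(* With bound 0 there is no degree to lower, but [x = 0] and [R0] gives [y = 0]. *)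
move=> x y [|l] Rxy xl.
  have x0 := fil0P xl; have y0 : y = 0.
    by apply: R0; move: Rxy; rewrite x0 mulr0 addr0.
  by rewrite y0; apply: fil_zero.
have yl := bRz _ _ _ Rxy xl.
have [le_ij|lt_ij] := leqP (l.+1 + i) j.
  by apply: fil_leq yl; lia.
have -> : (l.+1 + i - j.+1 = (l.+1 + i - j).-1)%N by lia.
apply: (symbol_lower_r d1D yl).
set y1' := y1 - z * d1 in y1z.
(* This is f'(x) d1 - f'(d1) x = f'(x d1 - d1 x), from right linearity. *)
have R1 : R (x * d1 - d1 * x) ((y * d1 - y1' * x) + z * (x * d1 - d1 * x)).
  have -> : (y * d1 - y1' * x) + z * (x * d1 - d1 * x)
      = (y + z * x) * d1 - y1 * x.
    have cancel (a b c e : H) : a - (b - c) + (e - c) = a + e - b.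
      rewrite opprB [c - b]addrC (addrA a) -(addrA _ c) (addrCA c) subrr addr0.
      exact: addrAC.
    by rewrite /y1' mulrBl mulrDl mulrBr !mulrA cancel.
  exact: RB (RM _ _ d1 Rxy) (RM _ _ x Ry1).
have y1x : fil ((l.+1 + i - j) + n).-1 (y1' * x).
  have [m0|m_gt0] := posnP m.
    have -> : y1' = 0 by apply: fil0P; move: y1z; rewrite m0.
    by rewrite mul0r; apply: fil_zero.
  by apply: fil_leq (filM y1z xl); rewrite /m in m_gt0 *; lia.
have := bRz _ _ _ R1 (symbol_comm d1D xl) => yd1.
rewrite -[y * d1](subrK (y1' * x)); apply: filD => //.
by apply: fil_leq yd1; lia.
Qed.

(** The multipliers found by successive uses of [descent_step] add up to [z]. *)
Lemma descent (R : H -> H -> Prop) i j y1 y2 :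
  (forall x y x' y', R x y -> R x' y' -> R (x - x') (y - y')) ->
  (forall x y a, R x y -> R (x * a) (y * a)) ->
  (forall y, R 0 y -> y = 0) ->
  R d1 y1 -> R d2 y2 -> bounded_by R i 0 ->
  exists z, bounded_by (fun x y => R x (y + z * x)) i j.
Proof.
move=> RB RM R0 Ry1 Ry2 bR; elim: j => [|j [z bRz]].
  by exists 0 => x y l; rewrite mul0r addr0; apply: bR.
have := @descent_step (fun x y => R x (y + z * x)) i j (y1 - z * d1) (y2 - z * d2).
case=> [|||||//|z' bRz'].
- move=> x y x' y' Rxy Rxy'; have := RB _ _ _ _ Rxy Rxy'.
  by rewrite mulrBr opprD addrACA.
- by move=> x y a /(RM _ _ a); rewrite mulrDl mulrA.
- by move=> y; rewrite mulr0 addr0; apply: R0.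
- by rewrite subrK.
- by rewrite subrK.
exists (z' + z) => x y l; rewrite mulrDl addrA; exact: bRz'.
Qed.

(** * Central elements of the corner as maps on HeH *)

Section Corner.
Variable e : H.

(* The graph of the would-be map sending the sum of the a e b to that of the a w b. *)
Definition ideal_map (w x y : H) := exists s : seq (H * H),
  x = \sum_(p <- s) p.1 * e * p.2 /\ y = \sum_(p <- s) p.1 * w * p.2.

Definition in_HeH (x : H) := exists s : seq (H * H),
  x = \sum_(p <- s) p.1 * e * p.2.

Hypotheses (d1_HeH : in_HeH d1) (d2_HeH : in_HeH d2).

(** Such a [z] kills every a e b, hence [d1], which is not a zero divisor. *)
Lemma central_inj z : (forall x, z * x = x * z) -> z * e = 0 -> z = 0.
Proof.
move=> z_central ze; apply: (symbol_reg_r d1D).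
have [s ->] := d1_HeH; rewrite mulr_sumr big1 // => p _.
by rewrite !mulrA z_central -(mulrA p.1) ze mulr0 mul0r.
Qed.

Variable w : H.
Hypotheses (ew : e * w = w) (we : w * e = w).
Hypothesis w_comm : forall u, w * (e * u * e) = (e * u * e) * w.
Local Notation R := (ideal_map w).

Lemma ideal_map_sub x y x' y' : R x y -> R x' y' -> R (x - x') (y - y').
Proof.
case=> s [-> ->] [s' [-> ->]].
exists (s ++ [seq (- p.1, p.2) | p <- s']); rewrite !big_cat !big_map /=.
by rewrite -!sumrN; split; congr (_ + _); apply: eq_bigr => p _; rewrite !mulNr.
Qed.

Lemma ideal_map_mulr x y a : R x y -> R (x * a) (y * a).
Proof.
case=> s [-> ->]; exists [seq (p.1, p.2 * a) | p <- s]; rewrite !big_map !mulr_suml.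
by split; apply: eq_bigr => p _; rewrite mulrA.
Qed.

Lemma ideal_map_mull x y a : R x y -> R (a * x) (a * y).
Proof.
case=> s [-> ->]; exists [seq (a * p.1, p.2) | p <- s].
by rewrite !big_map !mulr_sumr; split; apply: eq_bigr => p _; rewrite !mulrA.
Qed.

(** In a e b a' w b' the elements [e] and [w] can change places: [w] commutes with e b a' e, so e b
    a' w = w b a' e. *)
Lemma ideal_map_sym x y x' y' : R x y -> R x' y' -> x * y' = y * x'.
Proof.
case=> s [-> ->] [s' [-> ->]]; rewrite !mulr_suml; apply: eq_bigr => p _.
rewrite !mulr_sumr; apply: eq_bigr => q _.
have E : w * p.2 * q.1 * e = e * p.2 * q.1 * w.
  by have := w_comm (p.2 * q.1); rewrite !mulrA we -(mulrA _ e w) ew.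
have -> : p.1 * e * p.2 * (q.1 * w * q.2) = p.1 * (e * p.2 * q.1 * w) * q.2.
  by rewrite !mulrA.
by rewrite -E !mulrA.
Qed.

Lemma in_HeHP x : in_HeH x -> exists y, R x y.
Proof. by case=> s ->; exists (\sum_(p <- s) p.1 * w * p.2), s. Qed.

(** Symmetry with [d1] gives d1 y = 0. Hence [R] is the graph of a well-defined map. *)
Lemma ideal_map_fun y : R 0 y -> y = 0.
Proof.
have [y1 Ry1] := in_HeHP d1_HeH => R0.
by apply: (symbol_reg_l d1D); rewrite (ideal_map_sym Ry1 R0) mulr0.
Qed.

Lemma central_lift : exists2 z, forall x, z * x = x * z & z * e = w.
Proof.
have [y1 Ry1] := in_HeHP d1_HeH; have [y2 Ry2] := in_HeHP d2_HeH.
have [m y1m] := fil_exists y1.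
(* A first bound for the map f with graph [R]: d1 f(x) = f(d1) x, and [symbol_lower_l] cancels [d1]
   from degree bounds. *)
have bR : bounded_by R m 0.
  move=> x y l Rxy xl; rewrite subn0; have [K] := fil_exists y.
  elim: K => [|K IHK] yK; first exact: fil_leq yK.
  have [le|lt] := leqP K.+1 (l + m); first exact: fil_leq yK.
  apply: IHK; apply: (symbol_lower_l d1D yK).
  by rewrite (ideal_map_sym Ry1 Rxy); apply: fil_leq (filM y1m xl); lia.
(* As [d1] lies in [fil n.+1], this many steps bring the bound for f(d1) - z d1 down to 0. *)
have [z bRz] := descent (m + n.+1) ideal_map_sub ideal_map_mulr ideal_map_fun
  Ry1 Ry2 bR.
have y1E : y1 = z * d1.
  apply/eqP; rewrite -subr_eq0; apply/eqP/fil0P.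
  have -> : 0%N = (n.+1 + m - (m + n.+1))%N by lia.
  by apply: bRz (symbol_fil d1D); rewrite subrK.
have d1z : d1 * z = z * d1.
  apply/eqP; rewrite -subr_eq0; apply/eqP/(symbol_reg_r d1D).
  by rewrite mulrBl -mulrA -y1E (ideal_map_sym Ry1 Ry1) subrr.
have Rz x y : R x y -> y = z * x.
  move=> Rxy; apply/eqP; rewrite -subr_eq0; apply/eqP/(symbol_reg_l d1D).
  by rewrite mulrBr (ideal_map_sym Ry1 Rxy) y1E mulrA d1z subrr.
exists z => [a|].
  apply/eqP; rewrite -subr_eq0; apply/eqP/(symbol_reg_r d1D).
  rewrite mulrBl -!mulrA -(Rz _ _ Ry1) -(Rz _ _ (ideal_map_mull a Ry1)).
  by rewrite subrr.
symmetry; apply: Rz; exists [:: (1, 1)].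
by rewrite !big_seq1 /= !mul1r !mulr1.
Qed.

End Corner.

End Descent.

(** * Elements of HeH with invariant symbols *)

Section Commutators.
Variable e : H.
Variable a0 : k.
Hypothesis eE : forall h, hnf h e = a0%:MP.

Definition vec v : H := hw 1 [:: v] 1%g.

Lemma hnf_vec h v : (msize (hnf h (vec v) - vlin v *+ (h == 1%g)) <= 1)%N.
Proof.
rewrite hnf_word scale1r invg1 mulg1.
by have := nfw_lead h [:: v]; rewrite /vword_mon big_seq1.
Qed.

Lemma msize_vlin (v : V) : (msize (vlin v) <= 2)%N.
Proof. exact: dhomog_msize_leq (vlin_homog v). Qed.

Lemma fil_vec v : fil 2 (vec v).
Proof.
move=> h; rewrite -[hnf h _](subrK (vlin v *+ (h == 1%g))); apply: msizeD_leq.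
  exact: leq_trans (hnf_vec h v) _.
by case: eqP => _; rewrite ?mulr0n ?msize0 //; apply: msize_vlin.
Qed.

Lemma vec_mull m v y h : fil m y ->
  (msize (hnf h (vec v * y) - vlin v * hnf h y) <= m)%N.
Proof.
move=> ym; rewrite -[X in msize X](subrKA (conv (vec v) y h)); apply: msizeD_leq.
  by apply: leq_trans (hnfM h (fil_vec v) ym) _; lia.
have -> : vlin v * hnf h y
    = \sum_g (vlin v *+ (g == 1)%g) * pact g (hnf (g^-1 * h)%g y).
  rewrite (bigD1 1%g) //= big1 ?addr0 => [|g /negPf ->].
    by rewrite eqxx invg1 mul1g mulr1n pact1.
  by rewrite mulr0n mul0r.
rewrite -sumrB; apply: msize_sum_leq => g _; rewrite -mulrBl.
apply: (msizeM_leq (hnf_vec g v)).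
exact: leq_trans (msize_pact _ _) (ym _).
Qed.

Lemma vec_mulr m v y h : fil m y ->
  (msize (hnf h (y * vec v) - hnf h y * vlin (rho h v)) <= m)%N.
Proof.
move=> ym; rewrite -[X in msize X](subrKA (conv y (vec v) h)); apply: msizeD_leq.
  by apply: leq_trans (hnfM h ym (fil_vec v)) _; lia.
have -> : hnf h y * vlin (rho h v)
    = \sum_g hnf g y * pact g (vlin v *+ (g^-1 * h == 1)%g).
  rewrite (bigD1 h) //= big1 ?addr0 => [|g gh].
    by rewrite mulVg eqxx mulr1n pact_vlin.
  by rewrite -eq_mulVg1 (negPf gh) raddf0 mulr0.
rewrite -sumrB; apply: msize_sum_leq => g _; rewrite -mulrBr -raddfB.
have := msizeM_leq (ym g) (leq_trans (msize_pact g _) (hnf_vec (g^-1 * h)%g v)).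
by rewrite addn1.
Qed.

(** For p = (t, v) this multiplies the top part at [h] by v - h t^-1 v, which is 0 at h = t. *)
Definition twisted_comm (p : gT * V) y := vec p.2 * y - y * vec (rho p.1^-1%g p.2).

(* Its component at h is symbolically a0 times the product over (t, v) in l of *)
(* v - h t^-1 v: the factors with t = h kill every component but that at 1.    *)
Definition iter_comm (l : seq (gT * V)) : H := foldr twisted_comm e l.

Lemma iter_comm_HeH l : in_HeH e (iter_comm l).
Proof.
elim: l => [|p l [s IHs]] /=.
  by exists [:: (1, 1)]; rewrite big_seq1 /= mul1r mulr1.
rewrite /twisted_comm IHs.
exists ([seq (vec p.2 * q.1, q.2) | q <- s]
  ++ [seq (- q.1, q.2 * vec (rho p.1^-1%g p.2)) | q <- s]).
rewrite big_cat !big_map /= mulr_sumr mulr_suml -sumrN.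
by congr (_ + _); apply: eq_bigr => q _; rewrite ?mulNr !mulrA.
Qed.

Definition iter_comm_symbol (l : seq (gT * V)) h : S :=
  a0 *: \prod_(p <- l) vlin (p.2 - rho (h * p.1^-1)%g p.2).

Lemma iter_comm_lead l h : (msize (hnf h (iter_comm l) - iter_comm_symbol l h) <= size l)%N.
Proof.
have iter_comm_fil m : (forall h, msize (hnf h (iter_comm m) - iter_comm_symbol m h) <= size m)%N ->
    fil (size m).+1 (iter_comm m).
  move=> IH g; rewrite -[hnf g _](subrK (iter_comm_symbol m g)); apply: msizeD_leq.
    exact: leq_trans (IH g) (leqnSn _).
  apply: leq_trans (msizeZ_le _ _) _.
  have := dhomog_msize_leq (vword_mon_homog [seq p.2 - rho (g * p.1^-1)%g p.2 | p <- m]).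
  by rewrite /vword_mon big_map size_map.
elim: l h => [|[t v] l IHl] h /=.
  by rewrite eE /iter_comm_symbol big_nil alg_mpolyC subrr msize0.
have lf := iter_comm_fil l IHl.
set x := iter_comm l in lf IHl *; set w := rho t^-1%g v.
have -> : hnf h (twisted_comm (t, v) x) - iter_comm_symbol ((t, v) :: l) h
    = (hnf h (vec v * x) - vlin v * hnf h x)
      - (hnf h (x * vec w) - hnf h x * vlin (rho h w))
      + vlin (v - rho (h * t^-1)%g v) * (hnf h x - iter_comm_symbol l h).
  have -> : rho h w = rho (h * t^-1)%g v by rewrite lin_actM comp_lfunE.
  rewrite /twisted_comm hnfB /iter_comm_symbol big_cons /= linearB /=.
  by rewrite -!mul_mpolyC; ring.
apply: msizeD_leq; last exact: msizeM_leq (msize_vlin _) (IHl h).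
by apply: msizeB_leq; [apply: vec_mull | apply: vec_mulr].
Qed.

Variable v : gT -> V.
Hypothesis v_moved : forall t, t != 1%g -> v t - rho t^-1%g (v t) != 0.
Hypothesis a0_neq0 : a0 != 0.

(** Every [h] other than 1 occurs with its own [v h], so its component is killed; taking all
    translates makes the product over [moved_vectors] invariant. *)
Definition orbit_pairs : seq (gT * V) :=
  [seq ((p.2 * p.1 * p.2^-1)%g, rho p.2 (v p.1)) | p : gT * gT in [pred p | p.1 != 1%g]].

Definition moved_vectors : seq V :=
  [seq rho p.2 (v p.1 - rho p.1^-1%g (v p.1)) | p : gT * gT in [pred p | p.1 != 1%g]].

Lemma vlin_eq0 (u : V) : (vlin u == 0) = (u == 0).
Proof.
apply/eqP/eqP => [u0|->]; last exact: linear0.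
rewrite [u]vb_sum big1 // => i _.
by rewrite -(mcoeff_lform (fun j => coord (vbasis {:V}) j u)) -/(vlin u) u0 mcoeff0 scale0r.
Qed.

Lemma iter_comm_symbolP : symbol (iter_comm orbit_pairs) (size moved_vectors)
  (a0 *: \prod_(u <- moved_vectors) vlin u).
Proof.
split.
- exact/dhomogZ/vword_mon_homog.
- rewrite scaler_eq0 (negPf a0_neq0) /= prodf_seq_neq0.
  apply/allP => _ /fintype.imageP[[t h] /= t1 ->]; rewrite vlin_eq0.
  by rewrite -(linear0 (rho h)) (inj_eq (@act_inj _ _ _ rho h)) v_moved.
- move=> g; rewrite pactZ -/(vword_mon moved_vectors) pact_vword; congr (_ *: _).
  rewrite /vword_mon big_map !big_image /=.
  rewrite [RHS](reindex (fun p : gT * gT => (p.1, (g * p.2)%g))) /=.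
    by apply: eq_bigr => -[t h] _ /=; rewrite lin_actM comp_lfunE.
  exists (fun p => (p.1, (g^-1 * p.2)%g)) => -[t h] _ /=; first by rewrite mulKg.
  by rewrite mulKVg.
move=> h; have -> : size moved_vectors = size orbit_pairs by rewrite !size_map.
have := iter_comm_lead orbit_pairs h; congr (msize (_ - _) <= _)%N.
rewrite /iter_comm_symbol.
have [->|h1] := eqVneq h 1%g.
  rewrite mulr1n !big_image; congr (_ *: _); apply: eq_bigr => -[t g] /= _.
  congr (vlin _); rewrite mul1g !invMg invgK linearB /=.
  by rewrite -!comp_lfunE -!lin_actM mulgA mulgKV.
(* The pair indexed by [(h, 1)] contributes the factor v h - h h^-1 v h = 0. *)
rewrite mulr0n big_image (bigD1 (h, 1%g)) //=.
by rewrite invg1 mulg1 mul1g mulgV lin_act1 !id_lfunE subrr linear0 mul0r scaler0.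
Qed.

End Commutators.

(** * Coprimality of the two symbols *)

Section CornerCentre.
Variables (v1 v2 : gT -> V).
Hypothesis v1_moved : forall t, t != 1%g -> v1 t - rho t^-1%g (v1 t) != 0.
Hypothesis v2_moved : forall t, t != 1%g -> v2 t - rho t^-1%g (v2 t) != 0.
Hypothesis v1v2 : forall t t' h c, t != 1%g -> t' != 1%g ->
  v2 t' - rho t'^-1%g (v2 t') != c *: rho h (v1 t - rho t^-1%g (v1 t)).

Lemma coord_neq0 (u : V) : u != 0 -> exists i, coord (vbasis {:V}) i u != 0.
Proof.
move=> u0; apply/existsP; apply: contraNT u0 => /existsPn u0.
rewrite [u]vb_sum big1 // => i _.
by have := u0 i; rewrite negbK => /eqP ->; rewrite scale0r.
Qed.

Lemma prime_vlin (u : V) : u != 0 -> prime_elt (vlin u).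
Proof.
by case/coord_neq0 => i ui; exact: prime_lform ui.
Qed.

Lemma divides_vlin (u u' : V) : u != 0 -> divides (vlin u) (vlin u') ->
  exists c, u' = c *: u.
Proof.
case/coord_neq0 => i ui /(divides_lform ui) E.
exists (coord (vbasis {:V}) i u' / coord (vbasis {:V}) i u).
rewrite {1}[u']vb_sum [X in _ *: X]vb_sum scaler_sumr; apply: eq_bigr => j _.
by rewrite scalerA -E.
Qed.

(** The factors are prime linear forms, and by [v1v2] none coming from [v1] divides one coming from
    [v2]. *)
Lemma moved_coprime (a : k) (p q : S) : a != 0 ->
  p * (a *: \prod_(u <- moved_vectors v2) vlin u)
    = q * (a *: \prod_(u <- moved_vectors v1) vlin u) ->
  exists t, p = t * (a *: \prod_(u <- moved_vectors v1) vlin u).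
Proof.
move=> a0; rewrite -!scalerAr => /(scalerI a0) E.
have moved1 : {in moved_vectors v1, forall u, u != 0}.
  move=> _ /fintype.imageP[[t h] /= t1 ->].
  by rewrite -(linear0 (rho h)) (inj_eq (@act_inj _ _ _ rho h)) v1_moved.
have [|||r Er] := @coprime_prod_divides _ (map (@vlin k V) (moved_vectors v1))
    (map (@vlin k V) (moved_vectors v2)) p.
- by move=> _ /mapP[u /moved1 u0 ->]; apply: prime_vlin.
- move=> _ _ /mapP[u u1 ->] /mapP[u' u2 ->] /(divides_vlin (moved1 _ u1))[c].
  case/fintype.imageP: u1 u2 => [[t h] /= t1 ->].
  case/fintype.imageP=> [[t' h'] /= t'1 ->] E'.
  have /eqP := v1v2 (h'^-1 * h)%g c t1 t'1; apply.
  apply: (@act_inj _ _ _ rho h').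
  by rewrite E' lin_actM comp_lfunE linearZ /= act_invK.
- by move: E; rewrite !big_map => E; exists q.
exists (a^-1 *: r); rewrite Er big_map -scalerAl -scalerAr scalerA mulVf //.
by rewrite scale1r.
Qed.

Variables (e : H) (a0 : k).
Hypothesis a0_neq0 : a0 != 0.
Hypothesis eE : forall h, hnf h e = a0%:MP.

Let d1P := iter_comm_symbolP eE v1_moved a0_neq0.
Let d2P := iter_comm_symbolP eE v2_moved a0_neq0.

Lemma corner_central_inj z : (forall x, z * x = x * z) -> z * e = 0 -> z = 0.
Proof. exact: (central_inj d1P (iter_comm_HeH e _)). Qed.

Lemma corner_central_lift w : e * w = w -> w * e = w ->
  (forall u, w * (e * u * e) = (e * u * e) * w) ->
  exists2 z, forall x, z * x = x * z & z * e = w.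
Proof.
move=> ew we w_comm.
have sz : size (moved_vectors v2) = size (moved_vectors v1) by rewrite !size_map.
have d2P' := d2P; rewrite sz in d2P'.
exact: (central_lift d1P d2P' (fun p q => @moved_coprime _ p q a0_neq0)
  (iter_comm_HeH e _) (iter_comm_HeH e _) ew we w_comm).
Qed.

End CornerCentre.

End FilteredAlgebra.

(** * The choice of linear forms *)

(** Adding 1 to the polynomial with roots [s] gives one whose roots avoid [s]. *)
Lemma closed_field_avoid (k : closedFieldType) (s : seq k) : exists a, a \notin s.
Proof.
case: s => [|b s]; first by exists 0.
pose p := \prod_(a <- b :: s) ('X - a%:P) : {poly k}.
have sz : size (p + 1) = (size s).+2.
  by rewrite size_polyDl size_prod_XsubC // size_poly1.
have /closed_rootP[a] : size (p + 1) != 1%N by rewrite sz.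
rewrite /root hornerD hornerC => pa; exists a.
apply/negP; rewrite -root_prod_XsubC => /rootP; rewrite -/p => pa0.
by move: pa; rewrite pa0 add0r oner_eq0.
Qed.

Lemma avoid_unique (k : closedFieldType) (T : eqType) (s : seq T) (P : T -> k -> Prop) :
  (forall t a b, P t a -> P t b -> a = b) ->
  exists a, forall t, t \in s -> ~ P t a.
Proof.
move=> P_unique.
have [r rP] : exists r : seq k, forall t a, t \in s -> P t a -> a \in r.
  elim: s => [|t s [r rP]]; first by exists [::].
  have [[a Pa]|nP] := pselect (exists a, P t a); last first.
    exists r => t' a; rewrite inE => /predU1P[->|]; last exact: rP.
    by move=> Pta; case: nP; exists a.
  exists (a :: r) => t' b; rewrite inE => /predU1P[->|t's Pb].
    by move=> Pb; rewrite (P_unique t b a) ?mem_head.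
  by rewrite inE (rP t') ?orbT.
have [a ar] := closed_field_avoid r; exists a => t ts Pta.
by rewrite (rP t) in ar.
Qed.

Section TransversalVectors.
Variables (k : closedFieldType) (V : vectType k) (gT : finGroupType).
Variable rho : linear_action V gT.
Hypothesis two_vectors : forall t : gT, t != 1%g -> exists x y : V,
  forall a b, a *: (x - rho t x) + b *: (y - rho t y) = 0 -> a = 0 /\ b = 0.

(** Take v1 = x and v2 = x + z y with x, y from [two_vectors]. Each line spanned by a translate of a
    moved vector of v1 rules out at most one value of [z t], and there are finitely many such
    lines. *)
Lemma transversal_vectors : exists v1 v2 : gT -> V,
  [/\ forall t, t != 1%g -> v1 t - rho t^-1%g (v1 t) != 0,
      forall t, t != 1%g -> v2 t - rho t^-1%g (v2 t) != 0
    & forall t t' h c, t != 1%g -> t' != 1%g ->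
      v2 t' - rho t'^-1%g (v2 t') != c *: rho h (v1 t - rho t^-1%g (v1 t))].
Proof.
have [|xy xyP] := @choice gT (V * V)%type (fun t q => t != 1%g -> forall a b,
    a *: (q.1 - rho t^-1%g q.1) + b *: (q.2 - rho t^-1%g q.2) = 0 ->
    a = 0 /\ b = 0).
  move=> t; have [t1|t1] := eqVneq t 1%g; first by exists (0, 0).
  have [|x [y xyP]] := two_vectors (t := t^-1%g); first by rewrite invg_eq1.
  by exists (x, y).
pose x t := (xy t).1; pose y t := (xy t).2.
pose d t (v : V) := v - rho t^-1%g v.
have dE t a : d t (x t + a *: y t) = d t (x t) + a *: d t (y t).
  by rewrite /d linearD linearZ scalerBr opprD addrACA.
pose B := [seq rho p.1 (d p.2 (x p.2)) | p : gT * gT in [pred p | p.2 != 1%g]].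
have [|z zP] := @choice gT k (fun t a => t != 1%g -> forall b c, b \in B ->
    d t (x t + a *: y t) != c *: b).
  move=> t; have [t1|t1] := eqVneq t 1%g; first by exists 0.
  have [|a aP] := @avoid_unique k V B (fun b a => exists c, d t (x t + a *: y t) = c *: b).
    move=> b a1 a2 [c1 E1] [c2 E2].
    (* Eliminating [b] from [E1] and [E2] leaves a relation between independent vectors, so c1 = c2
       and c2 a1 = c1 a2. *)
    have [] := xyP t t1 (c2 - c1) (c2 * a1 - c1 * a2).
      transitivity (c2 *: d t (x t + a1 *: y t) - c1 *: d t (x t + a2 *: y t)).
        rewrite !dE -/(x t) -/(y t) -/(d t (x t)) -/(d t (y t)).
        move: (d t (x t)) (d t (y t)) => u v.
        by rewrite !scalerDr !scalerA opprD addrACA -!scalerBl.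
      by rewrite E1 E2 !scalerA mulrC subrr.
    move/eqP; rewrite subr_eq0 => /eqP->.
    have [c0|c0] := eqVneq c1 0.
      have [|/eqP] := xyP t t1 1 a1; last by rewrite oner_eq0.
      by rewrite scale1r -/(x t) -/(y t) -/(d t _) -/(d t _) -dE E1 c0 scale0r.
    by rewrite -mulrBr => /eqP; rewrite mulf_eq0 (negPf c0) subr_eq0 => /eqP.
  by exists a => _ b c bB; apply/eqP => E; apply: (aP b bB); exists c.
exists x, (fun t => x t + z t *: y t); split=> [t t1|t t1|t t' h c t1 t'1].
- apply/eqP => x0; have [|/eqP] := xyP t t1 1 0; last by rewrite oner_eq0.
  by rewrite x0 scaler0 scale0r addr0.
- apply/eqP => /eqP; rewrite -/(d t _) dE => /eqP x0.
  have [|/eqP] := xyP t t1 1 (z t); last by rewrite oner_eq0.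
  by rewrite scale1r.
by apply: zP => //; apply/fintype.imageP; exists (h, t).
Qed.

End TransversalVectors.

(** * The centre of the corner algebra *)

Section CornerCentreOfSRA.
Variables (k : closedFieldType) (V : vectType k) (gT : finGroupType).
Variables (rho : linear_action V gT) (omega : {skew_symmetric V}).
Variable c : gT -> k.
Hypothesis gT_neq0 : #|gT|%:R != 0 :> k.
Hypothesis k_neq2 : 2%:R != 0 :> k.
Hypothesis omega_nondeg : nondegenerate omega.
Hypothesis rho_inj : injective rho.
Hypothesis omega_rho : forall g x y, omega (rho g x) (rho g y) = omega x y.
Hypothesis c_conj :
  forall s g, s \in sympl_refl rho -> c (s ^ g)%g = c s.

Local Notation kap := (kappa rho omega c).
Local Notation rel := (@sra_rel k V gT rho omega c).
Local Notation H := (sra rho omega c).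
Local Notation e := (sra_average rho omega c).

Lemma sra_relE z : rel z <-> exists x y,
  z = (skew_vect rho x * skew_vect rho y - skew_vect rho y * skew_vect rho x)
      - \sum_g kap g x y *: skew_group rho g.
Proof.
have E x y : omega x y *: skew_group rho 1%g
    - \sum_(s in sympl_refl rho) (c s * refl_form rho omega s x y) *: skew_group rho s
  = \sum_g kap g x y *: skew_group rho g.
  rewrite [in LHS]big_mkcond /=.
  transitivity (\sum_g (omega x y *+ (g == 1%g)) *: skew_group rho g
      - \sum_g (if g \in sympl_refl rho then c g * refl_form rho omega g x y else 0)
         *: skew_group rho g).
    congr (_ - _); last by apply: eq_bigr => g _; case: ifP; rewrite ?scale0r.
    rewrite (bigD1 1%g) //= big1 ?addr0 => [|g /negPf ->]; first by rewrite eqxx.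
    by rewrite mulr0n scale0r.
  by rewrite -sumrB; apply: eq_bigr => g _; rewrite -scalerBl.
by split=> -[x [y ->]]; exists x, y; rewrite E.
Qed.

Let kl g a u v y : kap g (a *: u + v) y = a * kap g u y + kap g v y.
Proof. exact: kappa_linear. Qed.

Let ka g x y : kap g x y = - kap g y x.
Proof. exact: kappa_anti. Qed.

Let kd g x : kap g x x = 0.
Proof. exact: kappa_diag. Qed.

Let kc g h x y : kap (h * g * h^-1)%g (rho h x) (rho h y) = kap g x y.
Proof. exact: kappa_conj. Qed.

Let kj g x y z : kap g x y *: (rho g z - z) + kap g y z *: (rho g x - x)
  + kap g z x *: (rho g y - y) = 0.
Proof. exact: kappa_jacobi. Qed.

Definition sra_nf h : H -> {mpoly k[\dim {:V}]} := @hnf k V gT rho kap rel h.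
Definition sra_word a u g : H := a *: hword rel u g.

Let nfl h u : (msize (nfw rho kap h u - vword_mon u *+ (h == 1%g)) <= size u)%N.
Proof. exact: nf_lead. Qed.

Let nfs h w : sorted (@le_ord _) w ->
  nfw rho kap h (map vb w) = word_mon w *+ (h == 1%g).
Proof. by move=> ws; rewrite /nfw mlin_ext_vb nf_sorted // size_map. Qed.

Lemma sra_nfB h x y : sra_nf h (x - y) = sra_nf h x - sra_nf h y.
Proof.
have hl := hnf_linear kl ka kd kc kj sra_relE h.
have -> : x - y = (-1) *: y + x by rewrite scaleN1r addrC.
by apply: etrans (hl (-1) y x) _; rewrite scaleN1r addrC.
Qed.

Lemma sra_nf_word h a u g : sra_nf h (sra_word a u g) = a *: nfw rho kap (h * g^-1)%g u.
Proof.
have hl := hnf_linear kl ka kd kc kj sra_relE h.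
have h0 : sra_nf h 0 = 0 by rewrite -(subrr 0) sra_nfB subrr.
rewrite -(hnf_word kl ka kd kc kj sra_relE) /sra_word -[a *: _ in LHS]addr0.
by apply: etrans (hl a _ 0) _; rewrite -/(sra_nf h 0) h0 addr0.
Qed.

Lemma sra_wordM a u g b v h :
  sra_word a u g * sra_word b v h = sra_word (a * b) (u ++ map (rho g) v) (g * h)%g.
Proof.
rewrite /sra_word -(hwordM rel u g v h) -scalerA.
apply: etrans (esym (quot_scaleAl _ _ _)) _; congr (_ *: _).
exact: esym (quot_scaleAr _ _ _).
Qed.

Lemma sra_wordD a b u g : sra_word (a + b) u g = sra_word a u g + sra_word b u g.
Proof. exact: scalerDl. Qed.

Lemma sra_word_linear a p b u v q g :
  sra_word a (p ++ (b *: u + v) :: q) g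
  = sra_word (a * b) (p ++ u :: q) g + sra_word a (p ++ v :: q) g.
Proof. by rewrite /sra_word hword_linear scalerDr scalerA. Qed.

Lemma sra_word_swap a p x y q g :
  sra_word a (p ++ x :: y :: q) g - sra_word a (p ++ y :: x :: q) g
  = \sum_s sra_word (a * kap s x y) (p ++ map (rho s) q) (s * g)%g.
Proof.
rewrite /sra_word -scalerBr (hword_swap sra_relE) scaler_sumr.
by apply: eq_bigr => s _; rewrite scalerA.
Qed.

Lemma sra_word_ind (P : H -> Prop) :
  P 0 -> (forall x y, P x -> P y -> P (x + y)) ->
  (forall a u g, P (sra_word a u g)) -> forall x, P x.
Proof.
move=> P0 PD Pw x; rewrite -[x]scale1r; move: (1 : k).
elim/hword_ind: x => [a|b x y Px Py a|u g a]; last exact: Pw.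
  by rewrite scaler0.
by rewrite scalerDr scalerA; apply: PD.
Qed.

(** The starting point of the twisted commutators: [e] has the same nonzero constant at every group
    element. *)
Lemma sra_nf_average h : sra_nf h e = (#|gT|%:R^-1)%:MP.
Proof.
have -> : e = \sum_g sra_word #|gT|%:R^-1 [::] g.
  rewrite /sra_average scaler_sumr; apply: eq_bigr => g _.
  by rewrite /sra_word /hword -sword_group.
rewrite (big_morph (sra_nf h) (id1 := 0) (op1 := +%R)); first last.
- by rewrite -(subrr 0) sra_nfB subrr.
- move=> x y; rewrite -{1}[y]opprK sra_nfB; congr (_ + _).
  by rewrite -[- y]sub0r sra_nfB -(subrr 0) sra_nfB subrr sub0r opprK.
rewrite (bigD1 h) //= big1 ?addr0 => [|g gh]; rewrite sra_nf_word.
  rewrite (nfs _ (w := [::])) // mulgV eqxx mulr1n /word_mon big_nil.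
  by rewrite alg_mpolyC.
by rewrite (nfs _ (w := [::])) // -eq_mulgV1 eq_sym (negPf gh) scaler0.
Qed.

Let a0_neq0 : #|gT|%:R^-1 != 0 :> k.
Proof. by rewrite invr_eq0. Qed.

Let two_vectors (t : gT) : t != 1%g -> exists x y : V,
  forall a b, a *: (x - rho t x) + b *: (y - rho t y) = 0 -> a = 0 /\ b = 0.
Proof.
move=> t1; have [_ [_ [/memv_imP[x ->] /memv_imP[y ->] xy]]] :=
  im_two_vectors gT_neq0 k_neq2 omega_nondeg rho_inj omega_rho t1.
by exists x, y.
Qed.

Lemma sra_central_inj (z : H) : centre z -> z * e = 0 -> z = 0.
Proof.
have [v1 [v2 [v1P v2P v12P]]] := transversal_vectors two_vectors.
exact: (corner_central_inj nfl nfs sra_nfB sra_nf_word sra_wordM sra_wordD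
  sra_word_linear sra_word_swap sra_word_ind v1P a0_neq0 sra_nf_average).
Qed.

Lemma sra_central_lift (w : H) : e * w = w -> w * e = w ->
  (forall u, w * (e * u * e) = (e * u * e) * w) ->
  exists2 z, centre z & z * e = w.
Proof.
have [v1 [v2 [v1P v2P v12P]]] := transversal_vectors two_vectors.
exact: (corner_central_lift nfl nfs sra_nfB sra_nf_word sra_wordM sra_wordD
  sra_word_linear sra_word_swap sra_word_ind v1P v2P v12P a0_neq0 sra_nf_average).
Qed.

End CornerCentreOfSRA.

(** * The map [theta] on central elements *)

Lemma central_corner (A : pzRingType) (e z : A) :
  e * e = e -> z * e = e * z -> e * z * e = z * e.
Proof. by move=> ee <-; rewrite -mulrA ee. Qed.

Lemma central_corner_comm (A : pzRingType) (e z x : A) :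
  centre z -> e * x = x -> x * e = x -> z * e * x = x * (z * e).
Proof. by move=> zc ex xe; rewrite -mulrA ex (zc e) mulrA xe. Qed.

Lemma centreB (A : pzRingType) (z z' : A) :
  centre z -> centre z' -> centre (z - z').
Proof. by move=> zc z'c x; rewrite mulrBl mulrBr zc z'c. Qed.

Lemma mulr_sub_eq0 (A : pzRingType) (e z z' : A) : z * e = z' * e -> (z - z') * e = 0.
Proof. by rewrite mulrBl => ->; rewrite subrr. Qed.

Lemma central_corner_mul (A : pzRingType) (e z z' : A) :
  e * e = e -> z * e = e * z -> e * (z * z') * e = (e * z * e) * (e * z' * e).
Proof.
move=> ee ze; rewrite !mulrA -(mulrA _ e e) ee.
by rewrite -(mulrA e z e) ze mulrA ee.
Qed.

Theorem theorem3p3 (k : closedFieldType) (p : nat) (V : vectType k)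
    (omega : {skew_symmetric V}) (gT : finGroupType)
    (rho : linear_action V gT) (c : gT -> k) :
  odd p -> p \in [pchar k] ->
  nondegenerate omega ->
  injective rho ->
  (forall g x y, omega (rho g x) (rho g y) = omega x y) ->
  <<sympl_refl rho>>%g = [set: gT] ->
  (forall s g, s \in sympl_refl rho -> c (s ^ g)%g = c s) ->
  ~~ (p %| #|gT|)%N ->
  let H := sra rho omega c in
  let e := sra_e rho omega c in
  let theta : H -> corner e := corner_proj e in
  [/\ (* theta is an algebra homomorphism on the centre of H *)
      [/\ theta 1 = 1,
          forall (a : k) (z z' : H), centre z -> centre z' ->
            theta (a *: z + z') = a *: theta z + theta z'
        & forall z z' : H, centre z -> centre z' ->
            theta (z * z') = theta z * theta z']
    & (* theta maps the centre of H bijectively onto the centre of eHe *)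
      set_bij (@centre H) (@centre (corner e)) theta].
Proof.
move=> p_odd pk omega_nd rho_inj omega_rho _ c_conj p_gT H e theta.
have gT_neq0 : #|gT|%:R != 0 :> k by rewrite -(dvdn_pcharf pk).
have k_neq2 : 2%:R != 0 :> k.
  rewrite -(dvdn_pcharf pk); apply: contraL p_odd.
  by rewrite (dvdn_prime2 (pcharf_prime pk)) // => /eqP ->.
pose E : sra rho omega c := sra_average rho omega c.
have EE : E * E = E := sra_averageK rho omega c.
have thetaE z : centre z -> corner_val (theta z) = z * E.
  by move=> zc; apply: (central_corner EE (zc E)).
have valE (x : corner e) : E * corner_val x = corner_val x /\ corner_val x * E = corner_val x.
  by split; [apply: in_cornerl (valP x) | apply: in_cornerr (valP x)].
split; first split.
- by apply: val_inj; rewrite /= mulr1 EE.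
- move=> a z z' _ _; apply: val_inj.
  apply: etrans (congr1 (fun t => t * E) (mulrDr E (a *: z) z')) _.
  apply: etrans (mulrDl _ _ _) _; apply: (congr1 (fun t => t + E * z' * E)).
  apply: etrans (congr1 (fun t => t * E) (esym (quot_scaleAr a E z))) _.
  exact: esym (quot_scaleAl a (E * z) E).
- move=> z z' zc z'c; apply: val_inj.
  exact: (@central_corner_mul _ E z z' EE (zc E)).
split.
- move=> z zc x; apply: val_inj; have [Ex xE] := valE x.
  apply: etrans (congr1 (fun t => t * corner_val x) (thetaE z zc)) _.
  apply: etrans _ (congr1 (fun t => corner_val x * t) (esym (thetaE z zc))).
  exact: (central_corner_comm zc Ex xE).
- move=> z z' /set_mem zc /set_mem z'c Ez.
  apply/eqP; rewrite -subr_eq0; apply/eqP.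
  apply: (sra_central_inj gT_neq0 k_neq2 omega_nd rho_inj omega_rho c_conj).
    exact: centreB zc z'c.
  apply: (@mulr_sub_eq0 _ E).
  have vE : corner_val (theta z) = corner_val (theta z') by rewrite Ez.
  have Ez1 := thetaE z zc.
  have Ez2 := thetaE z' z'c.
  have Ez3 : z * E = corner_val (theta z') := etrans (esym Ez1) vE.
  have Ez4 : z * E = z' * E := etrans Ez3 Ez2.
  exact: Ez4.
move=> w wc; have [Ew wE] := valE w.
have [|z zc zE] := sra_central_lift gT_neq0 k_neq2 omega_nd rho_inj omega_rho c_conj Ew wE.
  (* Centrality in the corner is commutation with all e u e. *)
  by move=> u; exact: (congr1 (@corner_val _ _ _ e) (wc (corner_proj e u))).
exists z => //; apply: val_inj.
exact: etrans (thetaE z zc) zE.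
Qed.
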